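(* Let $\mathsf{C}_{\bullet,M}=(H_\bullet,d_{\bullet,M})$ and $\mathsf{C}_{\bullet,m}=(H_\bullet,d_{\bullet,m})$ be two Hilbert complexes on the same Hilbert spaces $H_0,\dots,H_n$ such that, for each $q$, $d_{q,M}$ is a closed extension of $d_{q,m}$. Assume that $\mathsf{C}_{\bullet,M}$ is a Fredholm complex. Let $H^q(\mathsf{C}'_\bullet)$ be the cohomology of the complex of harmonic vectors of the pair $(\mathsf{C}_{\bullet,M},\mathsf{C}_{\bullet,m})$. Then for each $q$ there is an isomorphism of vector spaces $$H^{q}(\mathsf{C}'_{\bullet})\oplus \mathcal{H}^{q-1}_{m}(\mathsf{C}_{\bullet,M},\mathsf{C}_{\bullet,m})\cong H^{q}(\mathsf{C}_{\bullet,M})\oplus H^{q-1}(\mathsf{C}_{\bullet,M}).$$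
   Context: A Hilbert complex $(H_\bullet,d_\bullet)$ consists of Hilbert spaces $H_0,\dots,H_n$ and densely defined closed linear operators $d_q:D(d_q)\subset H_q\to H_{q+1}$, $0\le q\le n-1$, with $d_q(D(d_q))\subseteq D(d_{q+1})$ and $d_{q+1}\circ d_q=0$; by convention $H_{-1}=H_{n+1}=0$, $d_{-1}=0$, and $d_n=0$ with $D(d_n)=H_n$. Its cohomology is $H^q=\ker(d_q)/\operatorname{Im}(d_{q-1})$. The complex is Fredholm if every $H^q$ is finite dimensional. For a pair $\mathsf{C}_{\bullet,M},\mathsf{C}_{\bullet,m}$ of Hilbert complexes on the same Hilbert spaces with $D(d_{q,m})\subset D(d_{q,M})$ and $d_{q,M}|_{D(d_{q,m})}=d_{q,m}$ for all $q$, set $\delta_{q,m}:=(d_{q-1,M})^*$ and $\delta_{q,M}:=(d_{q-1,m})^*$ (Hilbert space adjoints, operators from $H_q$ to $H_{q-1}$); $\delta_{q,M}$ is a closed extension of $\delta_{q,m}$. Define $P_q:=d_{q-1,M}\circ\delta_{q,M}+\delta_{q+1,M}\circ d_{q,M}$ on $D(P_q)=\{s\in D(d_{q,M})\cap D(\delta_{q,M}) : d_{q,M}s\in D(\delta_{q+1,M}),\ \delta_{q,M}s\in D(d_{q-1,M})\}$. The operator $d_{q,M}$ maps $\ker(P_q)$ into $\ker(P_{q+1})$; let $d'_q:\ker(P_q)\to\ker(P_{q+1})$ be its restriction. The complex $\mathsf{C}'_\bullet=(\ker(P_\bullet),d'_\bullet)$ is the complex of harmonic vectors of the pair, and $H^q(\mathsf{C}'_\bullet)=\ker(d'_q)/\operatorname{Im}(d'_{q-1})$.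 $\mathcal{H}^{q}_{m}(\mathsf{C}_{\bullet,M},\mathsf{C}_{\bullet,m}):=\ker(d_{q,m})\cap\ker(\delta_{q,m})$. *)

(* Defs.v *)
From HB Require Import structures.
From mathcomp Require Import all_boot all_order all_algebra.
From mathcomp Require Import generic_quotient ring_quotient sesquilinear.
From mathcomp Require Import complex.
From mathcomp Require Import boolp classical_sets reals topology normedtype.

Set Implicit Arguments.
Unset Strict Implicit.
Unset Printing Implicit Defensive.

Import Order.TTheory GRing.Theory Num.Theory.
Import numFieldNormedType.Exports.

Local Open Scope ring_scope.
Local Open Scope quotient_scope.

(* Linear subspaces are [submodClosed] predicates of the library. *)

Section Subspaces.
Context {K : numFieldType} {V : lmodType K}.

Definition subsp (S : submodClosed V) : Type := {x : V | x \in S}.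

HB.instance Definition _ (S : submodClosed V) := SubType.on (subsp S).
HB.instance Definition _ (S : submodClosed V) := Choice.on (subsp S).
HB.instance Definition _ (S : submodClosed V) :=
  [SubChoice_isSubLmodule of subsp S by <:].

(* [submodClosed] does not inherit from [zmodClosed], on which the library's
   quotient of additive groups is based. *)
Definition zmodsp (S : submodClosed V) : {pred V} := S.

Lemma zmodsp_zmod (S : submodClosed V) : zmod_closed (zmodsp S).
Proof. exact: GRing.submod_closedB (submodClosedP S). Qed.

HB.instance Definition _ (S : submodClosed V) :=
  GRing.isZmodClosed.Build V (zmodsp S) (zmodsp_zmod S).

Definition lquot (S : submodClosed V) : Type := Quotient.quot (zmodsp S).

HB.instance Definition _ (S : submodClosed V) := GRing.Zmodule.on (lquot S).

Section QuotientModule.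
Variable S : submodClosed V.

Definition lquot_pi (x : V) : lquot S := \pi_(Quotient.quot (zmodsp S)) x.
Definition lquot_scale (a : K) (u : lquot S) : lquot S :=
  lquot_pi (a *: repr (u : Quotient.quot (zmodsp S))).

Lemma lquot_piP x y : lquot_pi x = lquot_pi y <-> x - y \in S.
Proof.
have -> : (x - y \in S) = (x - y \in zmodsp S) by [].
by rewrite (Quotient.idealrBE (zmodsp S)); split=> [h|/eqP //]; apply/eqP.
Qed.

Lemma lquot_repr (u : lquot S) : lquot_pi (repr (u : Quotient.quot (zmodsp S))) = u.
Proof. exact: reprK. Qed.

Lemma lquot_piD x y : lquot_pi (x + y) = lquot_pi x + lquot_pi y.
Proof. exact: (Quotient.pi_add (zmodsp S) x y). Qed.

Lemma lquot_piZ a x : lquot_pi (a *: x) = lquot_scale a (lquot_pi x).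
Proof.
apply/lquot_piP; rewrite -scalerBr rpredZ //; apply/lquot_piP.
by rewrite lquot_repr.
Qed.

Lemma lquot_scaleA a b u :
  lquot_scale a (lquot_scale b u) = lquot_scale (a * b) u.
Proof. by rewrite -(lquot_repr u) -!lquot_piZ scalerA. Qed.

Lemma lquot_scale1 : left_id 1 lquot_scale.
Proof. by move=> u; rewrite -(lquot_repr u) -lquot_piZ scale1r. Qed.

Lemma lquot_scaleDr : right_distributive lquot_scale +%R.
Proof.
move=> a u v; rewrite -(lquot_repr u) -(lquot_repr v).
by rewrite -lquot_piD -!lquot_piZ scalerDr lquot_piD.
Qed.

Lemma lquot_scaleDl u : {morph lquot_scale^~ u : a b / a + b}.
Proof.
move=> a b; rewrite -(lquot_repr u).
by rewrite -!lquot_piZ scalerDl lquot_piD.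
Qed.

HB.instance Definition _ := GRing.Zmodule_isLmodule.Build K (lquot S)
  lquot_scaleA lquot_scale1 lquot_scaleDr lquot_scaleDl.

End QuotientModule.

Definition capsp (S T : {pred V}) : {pred V} := [pred x | (x \in S) && (x \in T)].

Lemma capsp_submod (S T : submodClosed V) : submod_closed (capsp S T).
Proof.
split=> [|a x y]; rewrite !inE ?rpred0 // => /andP[Sx Tx] /andP[Sy Ty].
by rewrite !rpredD ?rpredZ.
Qed.

HB.instance Definition _ (S T : submodClosed V) :=
  GRing.isSubmodClosed.Build K V (capsp S T) (capsp_submod S T).

Definition tracesp (Z : submodClosed V) (B : {pred V}) : {pred subsp Z} :=
  [pred x | val x \in B].

Arguments tracesp : clear implicits.

Lemma tracesp_submod (Z B : submodClosed V) : submod_closed (tracesp Z B).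
Proof.
split=> [|a x y]; rewrite !inE ?raddf0 ?rpred0 // => Bx By.
by rewrite linearP rpredD ?rpredZ.
Qed.

HB.instance Definition _ (Z B : submodClosed V) :=
  GRing.isSubmodClosed.Build K (subsp Z) (tracesp Z B) (@tracesp_submod Z B).

Definition fullsp : {pred V} := [pred _ | true].

Lemma fullsp_submod : submod_closed fullsp.
Proof. by []. Qed.

HB.instance Definition _ := GRing.isSubmodClosed.Build K V fullsp fullsp_submod.

End Subspaces.
Arguments tracesp {K V} Z B.

Definition fin_dim (K : numFieldType) (V : lmodType K) : Prop :=
  exists (n : nat) (e : 'I_n -> V),
    forall v : V, exists c : 'I_n -> K, v = \sum_(i < n) c i *: e i.

Definition lin_iso (K : numFieldType) (U V : lmodType K) : Prop :=
  exists f : {linear U -> V}, bijective f.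

(* A linear operator whose domain [dom] is a linear subspace of [U]; the values
   of the underlying total function outside [dom] are irrelevant. *)
Record linop (K : numFieldType) (U V : lmodType K) := Linop {
  dom : submodClosed U;
  opfun :> U -> V;
  opfun_linear : forall a x y, x \in dom -> y \in dom ->
    opfun (a *: x + y) = a *: opfun x + opfun y
}.

Section Operators.
Context {K : numFieldType}.

Section Basics.
Context {U V : lmodType K}.
Implicit Types S T : linop U V.

Lemma linop0 T : T 0 = 0.
Proof.
have := opfun_linear (l := T) 1 (rpred0 (dom T)) (rpred0 (dom T)).
rewrite !scale1r addr0 => /esym/eqP.
by rewrite -subr_eq0 addrK => /eqP.
Qed.

Definition opext S T : Prop :=
  forall x, x \in dom S -> x \in dom T /\ T x = S x.

Definition lker T : {pred U} := [pred x | (x \in dom T) && (T x == 0)].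

Lemma lker_submod T : submod_closed (lker T).
Proof.
split=> [|a x y]; rewrite !inE ?rpred0 ?linop0 ?eqxx //.
move=> /andP[Dx /eqP Tx] /andP[Dy /eqP Ty].
by rewrite (opfun_linear (l := T)) // Tx Ty scaler0 addr0 eqxx rpredD ?rpredZ.
Qed.

HB.instance Definition _ T :=
  GRing.isSubmodClosed.Build K U (lker T) (lker_submod T).

Definition limg T : {pred V} :=
  [pred y | `[< exists x, x \in dom T /\ T x = y >]].

Lemma limg_submod T : submod_closed (limg T).
Proof.
split=> [|a x y]; rewrite !inE.
  by exists 0; rewrite rpred0 linop0.
move=> [u [Du <-]] [v [Dv <-]].
by exists (a *: u + v); rewrite opfun_linear // rpredD ?rpredZ.
Qed.

HB.instance Definition _ T :=
  GRing.isSubmodClosed.Build K V (limg T) (limg_submod T).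

Definition addop_dom S T : {pred U} := capsp (dom S) (dom T).

HB.instance Definition _ S T := GRing.SubmodClosed.on (addop_dom S T).

Lemma addop_linear S T a x y : x \in addop_dom S T -> y \in addop_dom S T ->
  S (a *: x + y) + T (a *: x + y) = a *: (S x + T x) + (S y + T y).
Proof.
rewrite !inE => /andP[Sx Tx] /andP[Sy Ty].
by rewrite !opfun_linear // scalerDr addrACA.
Qed.

Definition addop S T : linop U V :=
  Linop (dom := addop_dom S T) (@addop_linear S T).

Lemma linop_of_linear (f : {linear U -> V}) a x y :
  x \in fullsp -> y \in fullsp -> f (a *: x + y) = a *: f x + f y.
Proof. by move=> _ _; rewrite linearP. Qed.

Definition totalop (f : {linear U -> V}) : linop U V :=
  Linop (dom := fullsp) (linop_of_linear f).

End Basics.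

Section Composition.
Context {U V W : lmodType K}.
Variables (S : linop V W) (T : linop U V).

Definition compop_dom : {pred U} := [pred x | (x \in dom T) && (T x \in dom S)].

Lemma compop_dom_submod : submod_closed compop_dom.
Proof.
split=> [|a x y]; rewrite !inE ?linop0 ?rpred0 // => /andP[Dx Dy] /andP[Ex Ey].
by rewrite opfun_linear // !rpredD ?rpredZ.
Qed.

HB.instance Definition _ :=
  GRing.isSubmodClosed.Build K U compop_dom compop_dom_submod.

Lemma compop_linear a x y : x \in compop_dom -> y \in compop_dom ->
  S (T (a *: x + y)) = a *: S (T x) + S (T y).
Proof.
by rewrite !inE => /andP[? ?] /andP[? ?]; rewrite !opfun_linear.
Qed.

Definition compop : linop U W := Linop (dom := compop_dom) compop_linear.

End Composition.

Section Restriction.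
Context {U V : lmodType K}.
Variables (T : linop U V) (A : submodClosed U) (B : submodClosed V).
Hypothesis AB : forall x, x \in A -> x \in dom T /\ T x \in B.

Definition restr_fun (x : subsp A) : subsp B :=
  exist _ (T (val x)) (AB (valP x)).2.

Lemma restr_linear : linear restr_fun.
Proof.
move=> a x y; apply: val_inj; rewrite [RHS]linearP /=.
by rewrite -(opfun_linear (l := T)) ?(AB (valP _)).1.
Qed.

HB.instance Definition _ :=
  GRing.isLinear.Build K (subsp A) (subsp B) *:%R restr_fun restr_linear.

Definition restr : {linear subsp A -> subsp B} := restr_fun.

End Restriction.

(* For [S : U -> V] and [T : V -> W] with [im S] contained in [ker T], this is
   [ker T / im S]. *)
Definition cohomology (U V W : lmodType K) (S : linop U V) (T : linop V W) :=
  lquot (tracesp (lker T) (limg S)).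

HB.instance Definition _ (U V W : lmodType K) (S : linop U V) (T : linop V W) :=
  GRing.Lmodule.on (cohomology S T).

End Operators.

(* [K] is the field of real or of complex numbers and [theta] its conjugation. *)
Variant real_or_complex (R : realType) :
    forall K : numFieldType, {rmorphism K -> K} -> Prop :=
  | RealScalars : @real_or_complex R R idfun
  | ComplexScalars : @real_or_complex R R[i] conjc.

HB.mixin Record CompleteNormedModule_isHilbert (K : numFieldType)
    (theta : {rmorphism K -> K}) H of CompleteNormedModule K H := {
  inner : {dot H for theta};
  inner_norm : forall x : H, `|x| ^+ 2 = inner x x
}.

#[short(type="hilbertType")]
HB.structure Definition Hilbert (K : numFieldType) (theta : {rmorphism K -> K}) :=
  {H of CompleteNormedModule K H & CompleteNormedModule_isHilbert K theta H}.

Section UnboundedOperators.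
Context {K : numFieldType} {theta : {rmorphism K -> K}}.
Context {U V : hilbertType theta}.

Definition dense_op (T : linop U V) : Prop :=
  dense [set x : U | x \in dom T]%classic.

Definition closed_op (T : linop U V) : Prop :=
  closed [set p : U * V | p.1 \in dom T /\ T p.1 = p.2]%classic.

Variable T : linop U V.

Definition adj_rel (y : V) (z : U) : Prop :=
  forall x, x \in dom T -> inner (T x) y = inner x z.

Definition adj_dom : {pred V} := [pred y | `[< exists z, adj_rel y z >]].

Definition adj_fun (y : V) : U := xget 0 [set z | adj_rel y z]%classic.

Lemma adj_relP a y1 z1 y2 z2 :
  adj_rel y1 z1 -> adj_rel y2 z2 -> adj_rel (a *: y1 + y2) (a *: z1 + z2).
Proof. by move=> h1 h2 x Dx; rewrite !linearPr /= h1 // h2. Qed.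

Lemma adj_dom_submod : submod_closed adj_dom.
Proof.
split=> [|a y1 y2]; rewrite !inE.
  by exists 0 => x Dx; rewrite !linear0r.
by move=> [z1 h1] [z2 h2]; exists (a *: z1 + z2); apply: adj_relP.
Qed.

HB.instance Definition _ :=
  GRing.isSubmodClosed.Build K V adj_dom adj_dom_submod.

Hypothesis dT : dense_op T.

Lemma dense_orth0 (z : U) :
  (forall x, x \in dom T -> inner x z = 0) -> z = 0.
Proof.
move=> zD; apply/eqP; apply: contraT => z0.
have [||x [/= zx Dx]] := dT (O := ball z `|z|).
- by exists z; apply: ballxx; rewrite normr_gt0.
- exact: ball_open.
move: zx; rewrite -ball_normE /ball_ /= => /lt_geF <-.
have xz := zD _ Dx.
have zx : inner z x = 0.
  apply: etrans (hermC inner z x) _.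
  by rewrite -[RHS](mulr0 ((-1) ^+ false)) -(rmorph0 theta) -xz.
rewrite -(@ler_pXn2r _ 2) ?nnegrE // !inner_norm.
rewrite linearBr /= !linearBl /= xz zx subr0 sub0r opprK.
by rewrite -!inner_norm lerDl exprn_ge0.
Qed.

Lemma adj_rel_uniq y z1 z2 : adj_rel y z1 -> adj_rel y z2 -> z1 = z2.
Proof.
move=> h1 h2; apply/eqP; rewrite -subr_eq0; apply/eqP/dense_orth0 => x Dx.
by rewrite linearBr /= -h1 // -h2 // subrr.
Qed.

Lemma adj_funP y : y \in adj_dom -> adj_rel y (adj_fun y).
Proof. by rewrite inE => -[z hz]; exact: (xgetPex 0 (ex_intro _ z hz)). Qed.

Lemma adj_linear a y1 y2 : y1 \in adj_dom -> y2 \in adj_dom ->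
  adj_fun (a *: y1 + y2) = a *: adj_fun y1 + adj_fun y2.
Proof.
move=> D1 D2; apply: (@adj_rel_uniq (a *: y1 + y2)).
  by apply: adj_funP; rewrite rpredD ?rpredZ.
by apply: adj_relP; apply: adj_funP.
Qed.

(* [inner] is linear in its first argument. Density of [dom T] makes [z] unique
   in [adj_rel y z], so that [adj_fun] does not depend on a choice on [adj_dom]. *)
Definition adj : linop V U := Linop (dom := adj_dom) adj_linear.

End UnboundedOperators.

(* A Hilbert complex 0 -> H_0 -> ... -> H_n -> 0, as a family indexed by [int]
   which vanishes outside [0, n]; this makes d_q zero and everywhere defined
   for q = -1 and q = n. The differential H_p -> H_q is indexed by both p and
   q, with q = p + 1, so that d_(q-1) has codomain H_q rather than
   H_((q-1)+1). *)
Record hilbert_complex (K : numFieldType) (theta : {rmorphism K -> K}) (n : nat)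
    (H : int -> hilbertType theta) := HilbertComplex {
  cdiff : forall p q : int, q = p + 1 -> linop (H p) (H q);
  cdiff_dense : forall p q (pq : q = p + 1), dense_op (cdiff pq);
  cdiff_closed : forall p q (pq : q = p + 1), closed_op (cdiff pq);
  cdiff_dom : forall p q r (pq : q = p + 1) (qr : r = q + 1) (x : H p),
    x \in dom (cdiff pq) -> cdiff pq x \in dom (cdiff qr);
  cdiff_diff : forall p q r (pq : q = p + 1) (qr : r = q + 1) (x : H p),
    x \in dom (cdiff pq) -> cdiff qr (cdiff pq x) = 0;
  supported : forall q : int, ~~ (0 <= q <= n%:Z) -> forall x : H q, x = 0
}.

Section HilbertComplexes.
Context {K : numFieldType} {theta : {rmorphism K -> K}} {n : nat}.
Context {H : int -> hilbertType theta}.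
Implicit Types C CM Cm : hilbert_complex n H.

Definition prevE (q : int) : q = (q - 1) + 1 := esym (subrK 1 q).

Definition diff_in C (q : int) : linop (H (q - 1)) (H q) := cdiff C (prevE q).

Definition diff_out C (q : int) : linop (H q) (H (q + 1)) :=
  cdiff C (erefl (q + 1)).

Definition Hcoh C (q : int) : lmodType K := cohomology (diff_in C q) (diff_out C q).

Definition fredholm C : Prop := forall q : int, fin_dim (Hcoh C q).

Definition extension_pair CM Cm : Prop :=
  forall p q (pq : q = p + 1), opext (cdiff Cm pq) (cdiff CM pq).

Definition codiff C p q (pq : q = p + 1) : linop (H q) (H p) :=
  adj (cdiff_dense C pq).

(* In the next definitions (CM, Cm) is a pair of complexes as in
   [extension_pair]. With d_M = [cdiff CM] and d_m = [cdiff Cm], the maximal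
   codifferential delta_M = (d_m)^* is [codiff Cm] and the minimal one
   delta_m = (d_M)^* is [codiff CM]. *)

Definition laplacian_at CM Cm p q r (pq : q = p + 1) (qr : r = q + 1) :
    linop (H q) (H q) :=
  addop (compop (cdiff CM pq) (codiff Cm pq)) (compop (codiff Cm qr) (cdiff CM qr)).

Definition laplacian CM Cm (q : int) : linop (H q) (H q) :=
  laplacian_at CM Cm (prevE q) (erefl (q + 1)).

Lemma laplacian_atE CM Cm p q r (pq : q = p + 1) (qr : r = q + 1) :
  laplacian_at CM Cm pq qr = laplacian CM Cm q.
Proof.
have Ep : p = q - 1 by rewrite pq addrK.
by subst r p; rewrite (eq_irrelevance pq (prevE q)).
Qed.

Lemma laplacian_kerP CM Cm p q r (pq : q = p + 1) (qr : r = q + 1) (x : H q) :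
  x \in lker (laplacian CM Cm q) <->
  [/\ x \in dom (codiff Cm pq), codiff Cm pq x \in dom (cdiff CM pq),
      x \in dom (cdiff CM qr), cdiff CM qr x \in dom (codiff Cm qr)
    & cdiff CM pq (codiff Cm pq x) + codiff Cm qr (cdiff CM qr x) = 0].
Proof.
rewrite -(laplacian_atE CM Cm pq qr); split.
  by case/andP => /andP[/andP[? ?] /andP[? ?]] /eqP.
by case=> ? ? ? ? ?; apply/andP; split; [apply/andP; split; apply/andP|apply/eqP].
Qed.

Lemma diff_laplacian_ker CM Cm p q (pq : q = p + 1) (x : H p) :
  x \in lker (laplacian CM Cm p) ->
  x \in dom (cdiff CM pq) /\ cdiff CM pq x \in lker (laplacian CM Cm q).
Proof.
move=> /(laplacian_kerP CM Cm (prevE p) pq)[Dd Ddd Dx Ddx Px].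
split=> //; apply/(laplacian_kerP CM Cm pq (erefl (q + 1))).
have dx0 : cdiff CM (erefl (q + 1)) (cdiff CM pq x) = 0 by exact: cdiff_diff.
have -> : codiff Cm pq (cdiff CM pq x)
    = - cdiff CM (prevE p) (codiff Cm (prevE p) x).
  by apply/eqP; rewrite -addr_eq0 addrC Px.
have Dy : cdiff CM (prevE p) (codiff Cm (prevE p) x) \in dom (cdiff CM pq).
  exact: cdiff_dom.
have dy0 : cdiff CM pq (cdiff CM (prevE p) (codiff Cm (prevE p) x)) = 0.
  exact: cdiff_diff.
rewrite dx0 rpred0 linop0 -scaleN1r rpredZ //; split=> //.
  exact: cdiff_dom.
have := opfun_linear (l := cdiff CM pq) (-1) Dy (rpred0 _).
by rewrite !addr0 linop0 addr0 dy0 scaler0.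
Qed.

Definition harmonic_diff CM Cm p q (pq : q = p + 1) :
    {linear subsp (lker (laplacian CM Cm p)) -> subsp (lker (laplacian CM Cm q))} :=
  restr (fun x => diff_laplacian_ker (x := x) pq).

Definition harmonic_Hcoh CM Cm (q : int) : lmodType K :=
  cohomology (totalop (harmonic_diff CM Cm (prevE q)))
             (totalop (harmonic_diff CM Cm (erefl (q + 1)))).

Definition harmonic_m CM Cm (q : int) : lmodType K :=
  subsp (capsp (lker (diff_out Cm q)) (lker (codiff CM (prevE q)))).

End HilbertComplexes.

(* Main.v *)
Require Import Defs.
From HB Require Import structures.
From mathcomp Require Import all_boot all_order all_algebra.
From mathcomp Require Import sesquilinear complex ring.
From mathcomp Require Import boolp classical_sets reals topology normedtype.

(** Write [d] and [delta] for the maximal operators [d_M] and [delta_M]. A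
    harmonic vector [s] with [d s = 0] satisfies [d (delta s) = 0], and the
    isomorphism sends [([s], k)] to [([s], [delta s + k])].

    It is injective: if [s = d t] and [delta s + k] is exact, pairing with [k]
    gives [k = 0], and correcting [t] by elements of [ker d] makes it harmonic.
    It is surjective because every class of degree [q] has a representative
    orthogonal to the exact vectors, and every closed vector of degree [q - 1]
    is, up to an exact one, the sum of some [delta (d t)] and of an element of
    the kernel of both [d_m] and [delta_m].

    Both arguments solve [delta_m w = u] for [u] orthogonal to [ker d], and use
    that the range of [d] is closed; this is where the Fredholm hypothesis
    enters, through the closed range theorem. *)

Set Implicit Arguments.
Unset Strict Implicit.
Unset Printing Implicit Defensive.

Import Order.TTheory GRing.Theory Num.Theory.
Import numFieldNormedType.Exports.
(* Gives precedence to [lker] and [limg] of [Defs] over those of [vector]. *)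
Import Defs.

Local Open Scope ring_scope.

(** * Real and complex scalars *)

Section Scalars.
Context (R : realType) (K : numFieldType) (theta : {rmorphism K -> K}).
Hypothesis RC : real_or_complex R theta.

Lemma mul_conj (x : K) : x * theta x = `|x| ^+ 2.
Proof. case: RC x => x /=; first by rewrite real_normK ?num_real. by rewrite sqr_normc. Qed.

Lemma ge0_inf (A : set K) : (A !=set0)%classic -> (forall a, A a -> 0 <= a) ->
  exists m, [/\ 0 <= m, forall a, A a -> m <= a
              & forall e, 0 < e -> exists2 a, A a & a < m + e].
Proof.
have infR (B : set R) : (B !=set0)%classic -> (forall a, B a -> 0 <= a) ->
    exists m, [/\ 0 <= m, forall a, B a -> m <= a
                & forall e, 0 < e -> exists2 a, B a & a < m + e].
  move=> B0 Bge; have lB : has_inf B by split=> //; exists 0.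
  exists (inf B); split=> [|a Ba|e e0].
  - exact: lb_le_inf.
  - by apply: ge_inf => //; exists 0.
  - by have [a Ba ae] := inf_adherent e0 lB; exists a.
case: RC A => A; first exact: infR.
move=> [a0 Aa0] Age.
have AE a : A a -> a = (complex.Re a)%:C%C.
  by move=> /Age a_ge0; rewrite RRe_real ?ger0_real.
have [||m [m0 mB mA]] := infR [set complex.Re a | a in A]%classic.
- by exists (complex.Re a0), a0.
- by move=> _ [a Aa <-]; rewrite -ler0c -AE ?Age.
exists (m%:C%C); split=> [|a Aa|e e0].
- by rewrite ler0c.
- by rewrite (AE _ Aa) lecR mB //; exists a.
- have eE : e = (complex.Re e)%:C%C by rewrite RRe_real ?gtr0_real.
  move: e0; rewrite eE ltcR => /mA[_ [a Aa <-] ame].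
  by exists a => //; rewrite (AE _ Aa) -rmorphD /= ltcR.
Qed.

Lemma ge0_archi (x : K) : 0 <= x -> exists n, x <= n%:R.
Proof.
have archiR (y : R) : exists n, y <= n%:R.
  by exists (Num.bound `|y|); rewrite (le_trans (ler_norm y)) ?ltW ?archi_boundP.
case: RC x => x x0; first exact: archiR.
have [n xn] := archiR (complex.Re x); exists n.
by rewrite -(RRe_real (ger0_real x0)) -(rmorph_nat (real_complex R)) lecR.
Qed.

End Scalars.

(** * Hilbert spaces *)

Section InnerProduct.
Context (K : numFieldType) (theta : {rmorphism K -> K}) (H : hilbertType theta).
Implicit Types x y z : H.

Lemma innerC x y : inner x y = theta (inner y x).
Proof. by rewrite (hermC inner x y) expr0 mul1r. Qed.

Lemma inner_eq0C x y : inner x y = 0 -> inner y x = 0.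
Proof. by move=> xy0; rewrite innerC xy0 rmorph0. Qed.

Lemma inner_self_eq0 x : inner x x = 0 -> x = 0.
Proof. by rewrite -inner_norm => /eqP; rewrite sqrf_eq0 normr_eq0 => /eqP. Qed.

Lemma sqr_normB x y : `|x - y| ^+ 2 =
  `|x| ^+ 2 - inner x y - inner y x + `|y| ^+ 2.
Proof. by rewrite !inner_norm linearBl /= !linearBr /= opprB addrA addrAC addrAC. Qed.

Lemma sqr_normD x y : `|x + y| ^+ 2 =
  `|x| ^+ 2 + inner x y + inner y x + `|y| ^+ 2.
Proof. by rewrite !inner_norm linearDl /= !linearDr /= addrA. Qed.

Lemma parallelogram x y :
  `|x + y| ^+ 2 + `|x - y| ^+ 2 = (`|x| ^+ 2 + `|y| ^+ 2) *+ 2.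
Proof.
rewrite sqr_normD sqr_normB.
rewrite mulr2n; set a := `|x| ^+ 2; set b := `|y| ^+ 2.
set c := inner x y; set d := inner y x.
have -> : a + c + d + b = (a + b) + (c + d) by rewrite -!addrA [b + _]addrCA [b + _]addrC.
have -> : a - c - d + b = (a + b) - (c + d).
  by rewrite -!addrA opprD; congr (_ + _); rewrite addrA addrC.
by rewrite addrACA subrr addr0.
Qed.

End InnerProduct.

Section CauchySchwarz.
Context (R : realType) (K : numFieldType) (theta : {rmorphism K -> K}).
Hypothesis RC : real_or_complex R theta.
Context (H : hilbertType theta).
Implicit Types x y z : H.

Lemma mul_innerC x y : inner x y * inner y x = `|inner x y| ^+ 2.
Proof. by rewrite (innerC y x) (mul_conj RC). Qed.

Lemma conj_real (a : K) : a \is Num.real -> theta a = a.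
Proof.
move=> ra; have [->|a0] := eqVneq a 0; first by rewrite rmorph0.
by apply: (mulfI a0); rewrite (mul_conj RC) real_normK.
Qed.

Lemma norm_conj (a : K) : `|theta a| = `|a|.
Proof.
have [->|a0] := eqVneq a 0; first by rewrite rmorph0.
have na0 : `|a| != 0 by rewrite normr_eq0.
apply: (mulfI na0); rewrite -normrM (mul_conj RC) -expr2.
by rewrite ger0_norm ?exprn_ge0.
Qed.

Lemma norm_innerC x y : `|inner x y| = `|inner y x|.
Proof. by rewrite innerC norm_conj. Qed.

Lemma cauchy_schwarz x y : `|inner x y| <= `|x| * `|y|.
Proof.
have [->|y0] := eqVneq y 0; first by rewrite linear0r normr0 mulr_ge0.
have ny0 : 0 < `|y| ^+ 2 by rewrite exprn_gt0 ?normr_gt0.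
rewrite -(@ler_pXn2r _ 2) ?nnegrE ?mulr_ge0 // exprMn -ler_pdivrMr //.
set t := inner x y / `|y| ^+ 2.
have : 0 <= `|x - t *: y| ^+ 2 by rewrite exprn_ge0.
rewrite sqr_normB !linearZr /= !linearZl /= normrZ exprMn.
have thT : theta t = inner y x / `|y| ^+ 2.
  by rewrite /t fmorph_div [theta (_ ^+ 2)]conj_real ?realX ?normr_real // -innerC.
rewrite thT /t normrM normfV exprMn.
rewrite (ger0_norm (ltW ny0)).
have -> : `|inner x y| ^+ 2 * (`|y| ^+ 2)^-1 ^+ 2 * `|y| ^+ 2 = `|inner x y| ^+ 2 / `|y| ^+ 2.
  by rewrite [_^-1 ^+ 2]expr2 -!mulrA mulVf ?mulr1 // gt_eqF.
have -> : inner y x / `|y| ^+ 2 * inner x y = `|inner x y| ^+ 2 / `|y| ^+ 2.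
  by rewrite mulrAC [inner y x * _]mulrC mul_innerC.
have -> : inner x y / `|y| ^+ 2 * inner y x = `|inner x y| ^+ 2 / `|y| ^+ 2.
  by rewrite mulrAC mul_innerC.
by rewrite subrK subr_ge0.
Qed.

End CauchySchwarz.

Section Complete.
Context (K : numFieldType) (V : completeNormedModType K).

Lemma le_norm_eps (x : V) (b : K) : 0 <= b ->
  (forall e, 0 < e -> `|x| <= b + e) -> `|x| <= b.
Proof.
move=> b0 xb; rewrite real_leNgt ?ger0_real ?normr_ge0 //; apply/negP => bx.
have e0 : 0 < (`|x| - b) / 2 by rewrite divr_gt0 ?subr_gt0 ?ltr0n.
have := xb _ e0; rewrite -lerBlDl lt_geF //.
by rewrite ltr_pdivrMr ?ltr0n // ltr_pMr ?subr_gt0 // ltr1n.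
Qed.

Lemma complete_approx (P : K -> V -> Prop) :
  (forall e, 0 < e -> exists x, P e x) ->
  (forall e e' x y, P e x -> P e' y -> `|x - y| <= e + e') ->
  exists l, forall e x, P e x -> `|x - l| <= e.
Proof.
move=> Pex Pcl.
have P_ge0 e x : P e x -> 0 <= e.
  move=> Px; have := Pcl _ _ _ _ Px Px.
  by rewrite subrr normr0 -mulr2n pmulrn_lge0.
pose B (e : K) := [set x : V | forall e' y, P e' y -> `|x - y| <= e + e']%classic.
pose F : set_system V := filter_from [set e : K | 0 < e]%classic B.
have FF : ProperFilter F.
  apply: filter_from_proper; last first.
    by move=> e /Pex[x Px]; exists x => e' y; apply: Pcl.
  apply: filter_from_filter; first by exists 1 => /=.
  move=> e e' /= e0 e'0; exists (Num.min e e').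
    by rewrite /= comparable_lt_min ?e0 ?e'0 // real_comparable ?gtr0_real.
  move=> x Bx; split=> e'' y Py; apply: le_trans (Bx _ _ Py) _; rewrite lerD2r.
    by rewrite comparable_ge_min ?lexx // real_comparable ?gtr0_real.
  by rewrite comparable_ge_min ?lexx ?orbT // real_comparable ?gtr0_real.
have cF : cauchy F.
  apply: cauchy_exP => e e0.
  have e30 : 0 < e / 3 by rewrite divr_gt0 ?ltr0n.
  have [y Py] := Pex _ e30; exists y; exists (e / 3) => // x Bx.
  rewrite -ball_normE /= distrC; apply: le_lt_trans (Bx _ _ Py) _.
  rewrite -mulrDr -{2}[e]mulr1 ltr_pM2l // -mulr2n -[_ *+ 2]mulr_natl.
  by rewrite ltr_pdivrMr ?ltr0n // mul1r ltr_nat.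
have /cvg_ex[l Fl] : cvg F by exact: cauchy_cvg.
exists l => e x Px; apply: le_norm_eps; first exact: P_ge0 Px.
move=> d d0; have d20 : 0 < d / 2 by rewrite divr_gt0 ?ltr0n.
have [c /= c0 Bc] : F (ball l (d / 2)) by apply: Fl; apply: nbhsx_ballx.
pose m := Num.min c (d / 2).
have cmp : (c >=< d / 2)%R by rewrite real_comparable ?gtr0_real.
have [z Pz] : exists z, P m z by apply: Pex; rewrite comparable_lt_min ?c0.
have zl : `|z - l| < d / 2.
  have : ball l (d / 2) z.
    apply: Bc => e' y Py; apply: le_trans (Pcl _ _ _ _ Pz Py) _.
    by rewrite lerD2r comparable_ge_min ?lexx.
  by rewrite -ball_normE /= distrC.
have xz : `|x - z| <= e + d / 2.
  apply: le_trans (Pcl _ _ _ _ Px Pz) _.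
  by rewrite lerD2l comparable_ge_min ?lexx ?orbT.
rewrite -(subrKA z); apply: le_trans (ler_normD _ _) _.
by rewrite [d in e + d]splitr addrA lerD // ltW.
Qed.

End Complete.

(** * Orthogonal projections *)

Section Subspaces.
Context (K : numFieldType).

Definition lsub (V : lmodType K) (S : set V) : Prop :=
  S 0 /\ forall a x y, S x -> S y -> S (a *: x + y).

Section LinearSubspace.
Context (V : lmodType K) (S : set V) (lS : lsub S).

Lemma lsubD x y : S x -> S y -> S (x + y).
Proof. by move=> Sx Sy; rewrite -[x]scale1r; apply: lS.2. Qed.

Lemma lsubZ a x : S x -> S (a *: x).
Proof. by move=> Sx; rewrite -[_ *: _]addr0; apply: lS.2 => //; case: lS. Qed.

Lemma lsubN x : S x -> S (- x).
Proof. by rewrite -scaleN1r; apply: lsubZ. Qed.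

Lemma lsubB x y : S x -> S y -> S (x - y).
Proof. by move=> Sx /lsubN; apply: lsubD. Qed.

End LinearSubspace.
End Subspaces.

Section Projection.
Context (R : realType) (K : numFieldType) (theta : {rmorphism K -> K}).
Hypothesis RC : real_or_complex R theta.
Context (U V : hilbertType theta).

Definition rel_closed (G : set (U * V)) : Prop := forall l m,
  (forall e, 0 < e -> exists x w, [/\ G (x, w), `|l - x| <= e & `|m - w| <= e]) ->
  G (l, m).

Lemma sqr_normBZ (H : hilbertType theta) (x y : H) t : `|x - t *: y| ^+ 2 =
  `|x| ^+ 2 - theta t * inner x y - t * inner y x + t * theta t * `|y| ^+ 2.
Proof.
by rewrite sqr_normB linearZr linearZl /= normrZ exprMn (mul_conj RC).
Qed.

Lemma eq0_le_eps (x M : K) : (forall e, 0 < e -> `|x| <= e * M) -> x = 0.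
Proof.
move=> xM; have M0 : 0 <= M by rewrite -[M]mul1r (le_trans _ (xM 1 _)).
apply/eqP; rewrite -normr_le0 real_leNgt ?normr_real ?real0 //.
apply/negP => x0; have M1 : 0 < M + 1 by rewrite ltr_wpDl.
have := xM (`|x| / (M + 1)) (divr_gt0 x0 M1).
by rewrite lt_geF // mulrAC ltr_pdivrMr // ltr_pM2l // ltrDl.
Qed.

Lemma proj_graph (G : set (U * V)) (u : U) (v : V) : lsub G -> rel_closed G ->
  exists x w, G (x, w) /\
    forall x' w', G (x', w') -> inner (u - x) x' + inner (v - w) w' = 0.
Proof.
move=> lG cG.
pose p (x : U) (w : V) : K := `|u - x| ^+ 2 + `|v - w| ^+ 2.
have p_ge0 x w : 0 <= p x w by rewrite addr_ge0 ?exprn_ge0.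
have [||d [d0 dlb dinf]] :=
  ge0_inf RC (A := [set a | exists x w, G (x, w) /\ a = p x w]%classic).
- by exists (p 0 0), 0, 0; split=> //; case: lG.
- by move=> _ [x [w [_ ->]]].
pose P e x w := [/\ 0 <= e, G (x, w) & 2 * p x w <= 2 * d + e ^+ 2].
have Pex e : 0 < e -> exists x w, P e x w.
  move=> e0; have [|_ [x [w [Gxw ->]]] /ltW pe] := dinf (e ^+ 2 / 2).
    by rewrite divr_gt0 ?exprn_gt0.
  exists x, w; split=> //; first exact: ltW.
  have -> : 2 * d + e ^+ 2 = 2 * (d + e ^+ 2 / 2) by field.
  by rewrite ler_pM2l ?ltr0n.
have Pdist e e' x w y s : P e x w -> P e' y s ->
    `|x - y| ^+ 2 + `|w - s| ^+ 2 <= (e + e') ^+ 2.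
  move=> [e0 Gx pe] [e'0 Gy pe'].
  pose mx := 2^-1 *: (x + y); pose mw := 2^-1 *: (w + s).
  have Gm : G (mx, mw) by exact: (lsubZ lG 2^-1 (lsubD lG Gx Gy)).
  have mid (H : hilbertType theta) (a b c : H) :
      `|a - b| ^+ 2 = 2 * `|c - a| ^+ 2 + 2 * `|c - b| ^+ 2
                      - 4 * `|c - 2^-1 *: (a + b)| ^+ 2.
    have := parallelogram (c - a) (c - b).
    have -> : c - a + (c - b) = 2 *: (c - 2^-1 *: (a + b)).
      rewrite scalerBr scalerA mulfV ?pnatr_eq0 // scale1r scaler_nat mulr2n.
      by rewrite addrACA opprD.
    have -> : c - a - (c - b) = b - a by rewrite opprB addrC subrKA.
    rewrite normrZ exprMn (ger0_norm (ler0n _ 2)) [`|b - a|]distrC => E.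
    apply/eqP; rewrite eq_sym subr_eq eq_sym addrC; apply/eqP.
    transitivity ((`|c - a| ^+ 2 + `|c - b| ^+ 2) *+ 2); last by ring.
    by rewrite -E; ring.
  have dm : d <= p mx mw by apply: dlb; exists mx, mw.
  move: pe pe'; rewrite -subr_ge0 => pe; rewrite -subr_ge0 => pe'.
  have h3 : 0 <= 4 * (p mx mw - d) by rewrite mulr_ge0 ?subr_ge0.
  have h4 : 0 <= 2 * (e * e') by rewrite !mulr_ge0.
  rewrite -subr_ge0.
  have -> : (e + e') ^+ 2 - (`|x - y| ^+ 2 + `|w - s| ^+ 2)
     = (2 * d + e ^+ 2 - 2 * p x w) + (2 * d + e' ^+ 2 - 2 * p y s)
       + 4 * (p mx mw - d) + 2 * (e * e').
    by rewrite (mid _ x y u) (mid _ w s v) -/mx -/mw /p; ring.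
  exact: addr_ge0 (addr_ge0 (addr_ge0 pe pe') h3) h4.
have sqD_le (a b c : K) : 0 <= a -> 0 <= c -> 0 <= b ^+ 2 ->
    a ^+ 2 + b ^+ 2 <= c ^+ 2 -> a <= c.
  move=> a0 c0 b0 abc; rewrite -(@ler_pXn2r _ 2) ?nnegrE //.
  by apply: le_trans abc; rewrite lerDl.
have [||l Pl] := complete_approx (P := fun e x => exists w, P e x w).
- by move=> e /Pex[x [w Pxw]]; exists x, w.
- move=> e e' x y [w Pxw] [s Pys]; apply: (sqD_le _ `|w - s|) => //.
  + by rewrite addr_ge0 //; [case: Pxw|case: Pys].
  + by rewrite exprn_ge0.
  + exact: Pdist Pxw Pys.
have [||m Pm] := complete_approx (P := fun e w => exists x, P e x w).
- by move=> e /Pex[x [w Pxw]]; exists w, x.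
- move=> e e' w s [x Pxw] [y Pys]; apply: (sqD_le _ `|x - y|) => //.
  + by rewrite addr_ge0 //; [case: Pxw|case: Pys].
  + by rewrite exprn_ge0.
  + by rewrite addrC; exact: Pdist Pxw Pys.
exists l, m; split.
  apply: cG => e e0; have [x [w Pxw]] := Pex e e0; exists x, w; split.
  - by case: Pxw.
  - by rewrite distrC; apply: Pl; exists w.
  - by rewrite distrC; apply: Pm; exists x.
move=> x' w' G'; pose M := `|x'| + `|w'|.
have M_ge0 : 0 <= M by rewrite addr_ge0.
apply: (@eq0_le_eps _ (M + M)) => e e0.
have [x [w Pxw]] := Pex e e0; have [_ Gx pe] := Pxw.
pose r := inner (u - x) x' + inner (v - w) w'.
have -> : inner (u - l) x' + inner (v - m) w'
    = r + (inner (x - l) x' + inner (w - m) w').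
  by rewrite /r addrACA -!linearDl /= !subrKA.
rewrite mulrDr (le_trans (ler_normD _ _)) // lerD //; last first.
  rewrite (le_trans (ler_normD _ _)) // mulrDr lerD //;
    rewrite (le_trans (cauchy_schwarz RC _ _)) // ler_wpM2r //.
    by apply: Pl; exists w.
  by apply: Pm; exists x.
pose N := `|x'| ^+ 2 + `|w'| ^+ 2.
have N_ge0 : 0 <= N by rewrite addr_ge0 ?exprn_ge0.
have NM : N <= M ^+ 2.
  have -> : M ^+ 2 = N + 2 * (`|x'| * `|w'|) by rewrite /M /N; ring.
  by rewrite lerDl !mulr_ge0.
have [N0|N0] := eqVneq N 0.
  have /andP[/eqP x0 /eqP w0] : (x' == 0) && (w' == 0).
    move/eqP: N0; rewrite paddr_eq0 ?exprn_ge0 //.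
    by rewrite !sqrf_eq0 !normr_eq0.
  by rewrite /r x0 w0 !linear0r addr0 normr0 mulr_ge0 // ltW.
have Ngt0 : 0 < N by rewrite lt_def N0.
have rE : theta r = inner x' (u - x) + inner w' (v - w).
  by rewrite rmorphD /= -!innerC.
pose t := r / N.
have tE : theta t = theta r / N.
  by rewrite /t fmorph_div [theta N](conj_real RC) // ger0_real.
have dt : d <= p (x + t *: x') (w + t *: w').
  apply: dlb; exists (x + t *: x'), (w + t *: w'); split=> //.
  by rewrite addrC [w + _]addrC; apply: (lG.2 t (x', w') (x, w)).
have pt : p (x + t *: x') (w + t *: w') = p x w - `|r| ^+ 2 / N.
  rewrite /p !opprD !addrA !sqr_normBZ -(mul_conj RC r).
  transitivity (p x w - theta t * r - t * theta r + t * theta t * N).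
    by rewrite rE /p /r /N; ring.
  have alg (a b c k : K) : k != 0 ->
      c - b / k * a - a / k * b + a / k * (b / k) * k = c - a * b / k.
    by move=> k0; field.
  by rewrite tE alg.
have rN : 2 * `|r| ^+ 2 <= e ^+ 2 * N.
  rewrite -ler_pdivrMr // -subr_ge0.
  have -> : e ^+ 2 - 2 * `|r| ^+ 2 / N
     = (2 * d + e ^+ 2 - 2 * p x w) + 2 * ((p x w - `|r| ^+ 2 / N) - d) by field.
  by rewrite addr_ge0 ?subr_ge0 // mulr_ge0 // subr_ge0 -pt.
rewrite -(@ler_pXn2r _ 2) ?nnegrE ?(mulr_ge0 (ltW e0) M_ge0) //.
rewrite exprMn; apply: le_trans (_ : 2 * `|r| ^+ 2 <= _).
  by rewrite mulr_natl mulr2n lerDl exprn_ge0.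
by apply: le_trans rN _; rewrite ler_wpM2l ?exprn_ge0 ?(ltW e0).
Qed.

End Projection.

Section Duality.
Context (R : realType) (K : numFieldType) (theta : {rmorphism K -> K}).
Hypothesis RC : real_or_complex R theta.

Definition approx_closed (V : hilbertType theta) (S : set V) : Prop :=
  forall l, (forall e, 0 < e -> exists2 x, S x & `|l - x| <= e) -> S l.

(* Equivalent to closedness for a linear subspace, but passes to finite
   extensions by pure algebra. *)
Definition has_proj (V : hilbertType theta) (S : set V) : Prop :=
  forall u, exists2 s, S s & forall s', S s' -> inner (u - s) s' = 0.

Definition orth (V : hilbertType theta) (S : set V) : set V :=
  [set z | forall x, S x -> inner z x = 0]%classic.

Lemma orth_lsub (V : hilbertType theta) (S : set V) : lsub (orth S).
Proof.
split=> [x _|a x y Ox Oy s Ss]; first by rewrite linear0l.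
by rewrite linearPl /= Ox // Oy // mulr0 addr0.
Qed.

Lemma orth_closed (V : hilbertType theta) (S : set V) : approx_closed (orth S).
Proof.
move=> l lS x Sx; apply: (@eq0_le_eps _ _ `|x|) => e e0.
have [y Oy ly] := lS e e0.
rewrite -[inner l x]subr0 -(Oy _ Sx) -linearBl /=.
by rewrite (le_trans (cauchy_schwarz RC _ _)) // ler_wpM2r.
Qed.

Lemma proj_closed (V : hilbertType theta) (S : set V) :
  lsub S -> approx_closed S -> has_proj S.
Proof.
move=> lS cS u.
pose G : set (V * V) := [set p | S p.1 /\ p.2 = 0]%classic.
have [||s [w [[/= Ss w0] os]]] := proj_graph RC (G := G) u 0.
- split=> [|a [x w] [y s] [/= Sx ->] [/= Sy ->]]; first by split=> //; case: lS.
  by split=> /=; [apply: lS.2|rewrite scaler0 addr0].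
- move=> l m lm; split=> /=.
    by apply: cS => e /lm[x [w [[/= Sx _] lx _]]]; exists x.
  apply/eqP; rewrite -normr_eq0; apply/eqP/(@eq0_le_eps _ _ 1) => e /lm[x [w [[/= _ ->] _]]].
  by rewrite subr0 normr_id mulr1.
exists s => // s' Ss'; have := os s' 0 (conj Ss' erefl).
by rewrite linear0r addr0.
Qed.

Definition rker (U V : hilbertType theta) (G : set (U * V)) : set U :=
  [set x | G (x, 0)]%classic.

Definition rimg (U V : hilbertType theta) (G : set (U * V)) : set V :=
  [set w | exists x, G (x, w)]%classic.

Section Adjoint.
Context (U V : hilbertType theta).
Implicit Type G : set (U * V).

Definition adjr G : set (V * U) :=
  [set q | forall x w, G (x, w) -> inner w q.1 = inner x q.2]%classic.

Lemma adjr_lsub G : lsub (adjr G).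
Proof.
split=> [x w _|a [y1 z1] [y2 z2] /= h1 h2 x w Gxw] /=; first by rewrite !linear0r.
by rewrite !linearPr /= (h1 _ _ Gxw) (h2 _ _ Gxw).
Qed.

Lemma adjr_closed G : rel_closed (adjr G).
Proof.
move=> l m lm x w Gxw /=; apply/eqP; rewrite -subr_eq0; apply/eqP.
apply: (@eq0_le_eps _ _ (`|w| + `|x|)) => e e0.
have [y [z [h ly mz]]] := lm e e0.
have -> : inner w l - inner x m = inner w (l - y) - inner x (m - z).
  by rewrite !linearBr /= (h _ _ Gxw) opprB addrA subrK.
rewrite (le_trans (ler_normB _ _)) // mulrDr lerD //;
  by rewrite (le_trans (cauchy_schwarz RC _ _)) // mulrC ler_wpM2r.
Qed.

Lemma rker_lsub G : lsub G -> lsub (rker G).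
Proof.
move=> lG; split=> [|a x y Gx Gy]; first exact: lG.1.
have := lG.2 a _ _ Gx Gy; rewrite /rker /=.
by rewrite (_ : _ + _ = (a *: x + y, 0)) //; congr pair; rewrite /= scaler0 addr0.
Qed.

Lemma rimg_lsub G : lsub G -> lsub (rimg G).
Proof.
move=> lG; split=> [|a v w [x Gx] [y Gy]]; first by exists 0; exact: lG.1.
by exists (a *: x + y); apply: (lG.2 a _ _ Gx Gy).
Qed.

Lemma rker_closed G : rel_closed G -> approx_closed (rker G).
Proof.
move=> cG l lG; apply: cG => e e0; have [x Gx lx] := lG e e0.
by exists x, 0; split=> //; rewrite subr0 normr0 ltW.
Qed.

(* If [(u, v) = (x, w) + (a, b)] with [(x, w)] in [G] and [(a, b)] orthogonal to
   [G], then [(b, - a)] lies in the adjoint, and the hypothesis says that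
   [(u, v)] is orthogonal to [(a, b)]. *)
Lemma adjr_bidual G (u : U) (v : V) : lsub G -> rel_closed G ->
  (forall y z, adjr G (y, z) -> inner u z = inner v y) -> G (u, v).
Proof.
move=> lG cG uv; have [x [w [Gxw oxw]]] := proj_graph RC u v lG cG.
set a := u - x in oxw; set b := v - w in oxw.
have oC x' w' : G (x', w') -> inner x' a + inner w' b = 0.
  by move=> /oxw E; rewrite [inner x' _]innerC [inner w' _]innerC -rmorphD E rmorph0.
have adj_ba : adjr G (b, - a).
  move=> x' w' /oC /eqP; rewrite addrC addr_eq0 => /eqP E.
  by rewrite E linearNr.
have : inner u a + inner v b - (inner x a + inner w b) = 0.
  by rewrite (oC _ _ Gxw) subr0 -(uv _ _ adj_ba) linearNr subrr.
rewrite opprD addrACA -!linearBl /= -!inner_norm => /eqP.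
rewrite paddr_eq0 ?exprn_ge0 // !sqrf_eq0 !normr_eq0 !subr_eq0.
by case/andP => /eqP-> /eqP->.
Qed.

Lemma rker_adjr G : rker (adjr G) = orth (rimg G).
Proof.
apply/seteqP; split=> y Hy.
  by move=> w [x Gxw]; apply: inner_eq0C; rewrite (Hy _ _ Gxw) linear0r.
move=> x w Gxw /=; rewrite linear0r.
by apply: inner_eq0C; apply: Hy; exists x.
Qed.

End Adjoint.

Section FiniteCodimension.
Context (V : hilbertType theta).

Lemma has_proj_add (S : set V) (v : V) : lsub S -> has_proj S ->
  has_proj [set x | exists c, S (x - c *: v)]%classic.
Proof.
move=> lS pS; have [s Ss os] := pS v; set v' := v - s in os.
move=> u; have [t St ot] := pS u.
have [v0|v0] := eqVneq v' 0.
  have Sv : S v by have /eqP := v0; rewrite subr_eq0 => /eqP->.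
  exists t; first by exists 0; rewrite scale0r subr0.
  move=> x [c Sx]; rewrite -[x](subrK (c *: v)) ot //.
  by apply: lsubD => //; apply: lsubZ.
pose c := inner (u - t) v' / inner v' v'.
have vv0 : inner v' v' != 0 by apply: contra_neq v0 => /inner_self_eq0.
exists (t + c *: v').
  exists c; rewrite /v' scalerBr addrA addrAC addrK.
  by apply: lsubB => //; apply: lsubZ.
have oS x : S x -> inner (u - (t + c *: v')) x = 0.
  move=> Sx; rewrite opprD addrA linearBl /= linearZl /= ot // os //.
  by rewrite mulr0 subr0.
move=> x [b Sx]; have -> : x = (x - b *: v) + b *: s + b *: v'.
  by rewrite scalerBr -addrA [b *: s + _]addrC !subrK.
rewrite linearDr /= oS ?add0r; last by apply: lsubD => //; apply: lsubZ.
rewrite linearZr /= opprD addrA linearBl /= linearZl /= divfK // subrr mulr0 //.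
Qed.

Lemma has_proj_fin_codim (W : lmodType K) (g : {linear W -> V}) n
    (phi : 'I_n -> {scalar W}) (X : set W) : lsub X ->
  has_proj (g @` [set x | X x /\ forall i, phi i x = 0])%classic ->
  has_proj (g @` X)%classic.
Proof.
move=> lX; pose Y k := [set x | X x /\ forall i : 'I_n, (i < k)%N -> phi i x = 0]%classic.
have lY k : lsub (Y k).
  split=> [|a x y [Xx Px] [Xy Py]].
    by split=> [|i _]; [exact: lX.1|rewrite linear0].
  split=> [|i ik]; first exact: lX.2.
  by rewrite linearP /= Px // Py // mulr0 addr0.
have lgY k : lsub (g @` Y k)%classic.
  split=> [|a _ _ [x Yx <-] [y Yy <-]].
    by exists 0; [exact: (lY k).1|rewrite linear0].
  by exists (a *: x + y); [exact: (lY k).2|rewrite linearP].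
have -> : [set x | X x /\ forall i, phi i x = 0]%classic = Y n.
  apply/seteqP; split=> x [Xx Px]; split=> // i; exact: (Px i (ltn_ord i)).
suff IH k : (k <= n)%N -> has_proj (g @` Y k)%classic -> has_proj (g @` Y 0%N)%classic.
  move=> /(IH n (leqnn n)); congr (has_proj (_ @` _)%classic).
  by apply/seteqP; split=> [x []|x Xx] //; split.
elim: k => // k IHk kn pY; apply: IHk; first exact: ltnW.
pose j := Ordinal kn.
have YS x : Y k x -> phi j x = 0 -> Y k.+1 x.
  move=> [Xx Px] jx; split=> // i; rewrite ltnS leq_eqVlt => /orP[ik|]; last exact: Px.
  by rewrite (_ : i = j) //; apply/val_inj/eqP.
have SY x : Y k.+1 x -> Y k x.
  by move=> [Xx Px]; split=> // i ik; apply: Px; exact: ltnW.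
have [[x1 Yx1 jx1]|nx1] := pselect (exists2 x1, Y k x1 & phi j x1 != 0).
  have -> : (g @` Y k)%classic
      = [set x | exists c, (g @` Y k.+1)%classic (x - c *: g x1)]%classic.
    apply/seteqP; split=> [_ [x Yx <-]|x [c [y Yy yE]]].
      pose c := phi j x / phi j x1; exists c, (x - c *: x1); last first.
        by rewrite linearB linearZ.
      apply: YS; first by apply: (lsubB (lY k)) => //; apply: (lsubZ (lY k)).
      by rewrite linearB linearZ /= divfK // subrr.
    exists (y + c *: x1); last by rewrite linearD linearZ /= yE subrK.
    by apply: (lsubD (lY k)); [exact: SY|exact: (lsubZ (lY k))].
  exact: has_proj_add.
suff -> : Y k = Y k.+1 by [].
apply/seteqP; split=> x Yx; last exact: SY.
apply: YS => //; apply/eqP; apply: contra_notT nx1 => jx.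
by exists x.
Qed.

End FiniteCodimension.
End Duality.

(** * The closed range theorem *)

Section ClosedRange.
Context (R : realType) (K : numFieldType) (theta : {rmorphism K -> K}).
Hypothesis RC : real_or_complex R theta.

Lemma ge0_pow3 (n : nat) : n%:R <= 3 ^+ n :> K.
Proof. by rewrite -natrX ler_nat ltnW // ltn_expl. Qed.

(* A gliding hump: vectors [y n] violating the bound are added with weights
   [3 ^- n], and with signs keeping [inner (z n.+1) (y n)] large; the tail after
   [z n.+1] is too small to undo this. *)
Lemma uniform_bound (U V : hilbertType theta) (A : set (V * U)) (X : set V) :
  lsub A -> lsub X -> approx_closed X ->
  (forall z, X z -> exists M, forall y t, X y -> A (y, t) ->
    `|inner z y| <= M * `|t|) ->
  exists2 C, 0 <= C & forall y t, X y -> A (y, t) -> `|y| <= C * `|t|.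
Proof.
move=> lA lX cX ptw; apply: contrapT => nC.
pose c n : K := n.+1%:R * 3 ^+ n.
have c_gt0 n : 0 < c n by rewrite mulr_gt0 ?ltr0n // exprn_gt0 ?ltr0n.
have bad n : exists p, [/\ X p.1, A p, `|p.1| = 1 & c n * `|p.2| < 1].
  apply: contrapT => nbad; apply: nC; exists (c n); first exact: ltW.
  move=> y t Xy Ayt; have [->|y0] := eqVneq y 0.
    by rewrite normr0 mulr_ge0 // ltW.
  have ny0 : 0 < `|y| by rewrite normr_gt0.
  have cn := ltW (c_gt0 n).
  rewrite real_leNgt ?(ger0_real (mulr_ge0 cn (normr_ge0 t))) ?normr_real //.
  apply/negP => yt; apply: nbad; exists (`|y|^-1 *: y, `|y|^-1 *: t); split=> /=.
  - exact: lsubZ.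
  - exact: (lsubZ lA `|y|^-1 Ayt).
  - by rewrite normrZ normfV normr_id mulVf // gt_eqF.
  - by rewrite normrZ normfV normr_id mulrCA ltr_pdivrMl // mulr1.
have [p Pp] := choice bad.
pose r n : K := 3 ^- n.
have r_gt0 n : 0 < r n by rewrite invr_gt0 exprn_gt0 ?ltr0n.
have rS n : r n = 3 * r n.+1.
  by rewrite /r exprS invfM mulrA mulfV ?mul1r // pnatr_eq0.
pose sg (a b : K) : K := if `|b| <= `|a + b| then 1 else -1.
have sg1 a b : `|sg a b| = 1 by rewrite /sg; case: ifP; rewrite ?normrN normr1.
have sgP a b : `|b| <= `|a + sg a b * b|.
  rewrite /sg; case: ifP => [|/negbT]; first by rewrite mul1r.
  rewrite -real_ltNge ?normr_real // => ab.
  rewrite mulN1r -[`|b|](addrK `|b|) lerBlDr.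
  have -> : `|b| + `|b| = `|(a + b) - (a - b)|.
    have -> : a + b - (a - b) = b *+ 2 by ring.
    by rewrite normrMn mulr2n.
  by rewrite (le_trans (ler_normB _ _)) // addrC lerD2l ltW.
pose fix z n : V :=
  if n is k.+1 then z k + (sg (inner (z k) (p k).1) (r k) * r k) *: (p k).1 else 0.
have Xz n : X (z n).
  elim: n => [|n IH] /=; first exact: lX.1.
  by apply: lsubD => //; apply: lsubZ => //; case: (Pp n).
have pp n : inner (p n).1 (p n).1 = 1.
  by rewrite -inner_norm; case: (Pp n) => _ _ -> _; rewrite expr1n.
have hump n : r n <= `|inner (z n.+1) (p n).1|.
  rewrite /= linearDl /= linearZl /= pp mulr1.
  by have := sgP (inner (z n) (p n).1) (r n); rewrite gtr0_norm.
have step n : `|z n.+1 - z n| = r n.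
  rewrite /= addrC addKr normrZ normrM sg1 mul1r gtr0_norm //.
  by case: (Pp n) => _ _ -> _; rewrite mulr1.
pose d n : K := 3 / 2 * r n.
have d_gt0 n : 0 < d n by rewrite mulr_gt0 // divr_gt0 ?ltr0n.
have dS n : d n = d n.+1 + r n by rewrite /d rS; field.
have dist_le n k : `|z (n + k)%N - z n| <= d n - d (n + k)%N.
  elim: k => [|k IH]; first by rewrite addn0 !subrr normr0.
  rewrite addnS -(subrKA (z (n + k)%N)) (le_trans (ler_normD _ _)) // step.
  apply: le_trans (lerD (lexx _) IH) _; rewrite (dS (n + k)%N).
  by rewrite le_eqVlt; apply/orP; left; apply/eqP; ring.
have dist n m : `|z n - z m| <= d n + d m.
  wlog nm : n m / (n <= m)%N.
    by move=> W; have [/W//|/ltnW/W] := leqP n m; rewrite distrC [d m + _]addrC.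
  rewrite distrC -(subnKC nm); apply: le_trans (dist_le _ _) _; rewrite lerD2l.
  by apply: (@le_trans _ _ 0); rewrite ?oppr_le0 ltW.
have d_small e : 0 < e -> exists n, d n <= e.
  move=> e0; have q0 : 0 < 3 / (2 * e) by rewrite divr_gt0 ?ltr0n ?mulr_gt0 ?ltr0n.
  have [n qn] := ge0_archi RC (ltW q0); exists n.
  have := le_trans qn (ge0_pow3 n).
  rewrite /d /r ler_pdivrMr ?mulr_gt0 ?ltr0n // ler_pdivrMr ?exprn_gt0 ?ltr0n //.
  rewrite ler_pdivrMr ?ltr0n //.
  by have -> : e * 3 ^+ n * 2 = 3 ^+ n * (2 * e) by ring.
have [||l zl] := @complete_approx _ V (fun e x => exists2 n, x = z n & d n <= e).
- by move=> e /d_small[n dn]; exists (z n), n.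
- move=> e e' _ _ [n -> ne] [m -> me]; apply: le_trans (dist n m) _; exact: lerD.
have {}zl n : `|z n - l| <= d n by apply: zl; exists n.
have Xl : X l.
  by apply: cX => e /d_small[n dn]; exists (z n); rewrite // distrC (le_trans (zl n)).
have [M lM] := ptw l Xl.
have bound n : n.+1%:R <= 2 * `|M|.
  have [Xp Ap p1 cp] := Pp n.
  have half : r n <= 2 * (`|M| * `|(p n).2|).
    have lz : `|inner (l - z n.+1) (p n).1| <= d n.+1.
      rewrite (le_trans (cauchy_schwarz RC _ _)) // p1 mulr1 distrC; exact: zl.
    have lp : `|inner l (p n).1| <= `|M| * `|(p n).2|.
      apply: le_trans (_ : `|M * `|(p n).2| | <= _); last by rewrite normrM normr_id.
      have := lM _ (p n).2 Xp; rewrite -surjective_pairing => /(_ Ap) lMp.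
      by rewrite (le_trans lMp) // real_ler_norm // ger0_real // (le_trans _ lMp).
    have rd : r n = 2 * (r n - d n.+1) by rewrite /d rS; field.
    rewrite rd ler_pM2l ?ltr0n // lerBlDr.
    apply: le_trans (hump n) _; rewrite -[z n.+1](subKr l) linearBl /=.
    by rewrite (le_trans (ler_normB _ _)) // lerD.
  have := ler_wpM2l (ltW (c_gt0 n)) half.
  have -> : c n * r n = n.+1%:R by rewrite /c /r mulfK // expf_neq0 // pnatr_eq0.
  move=> h; apply: le_trans h _.
  have -> : c n * (2 * (`|M| * `|(p n).2|)) = 2 * `|M| * (c n * `|(p n).2|) by ring.
  by rewrite ler_piMr ?mulr_ge0 // ltW.
have [n Mn] := ge0_archi RC (mulr_ge0 (ler0n _ 2) (normr_ge0 M)).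
have := le_trans (bound n) Mn.
by rewrite ler_nat ltnn.
Qed.

Lemma img_closed (U V : hilbertType theta) (A : set (V * U)) (X : set V) C :
  lsub A -> rel_closed A -> lsub X -> approx_closed X -> 0 <= C ->
  (forall y t, X y -> A (y, t) -> `|y| <= C * `|t|) ->
  approx_closed [set t | exists2 y, X y & A (y, t)]%classic.
Proof.
move=> lA cA lX cX C0 AC l lcl.
have approx e : 0 < e -> exists y t, [/\ X y, A (y, t), `|l - t| <= e & C * `|l - t| <= e].
  move=> e0; have C1 : 0 < C + 1 by rewrite ltr_wpDl.
  have [t [y Xy Ayt] lt] := lcl _ (divr_gt0 e0 C1).
  move: lt; rewrite ler_pdivlMr // mulrDr mulr1 => lt.
  exists y, t; split=> //; apply: le_trans lt.
    by rewrite lerDr mulr_ge0.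
  by rewrite mulrC lerDl.
pose P e y := X y /\ exists2 t, A (y, t) & C * `|l - t| <= e.
have [||y0 Py0] := @complete_approx _ V P.
- by move=> e /approx[y [t [Xy Ayt _ lt]]]; exists y; split=> //; exists t.
- move=> e e' x y [Xx [s Axs ls]] [Xy [t Ayt lt]].
  have Axy : A (x - y, s - t) by exact: (lsubB lA Axs Ayt).
  apply: le_trans (AC _ _ (lsubB lX Xx Xy) Axy) _.
  apply: le_trans (lerD ls lt); rewrite -mulrDr ler_wpM2l //.
  by rewrite -(subrKA l) (le_trans (ler_normD _ _)) // distrC.
exists y0.
  apply: cX => e /approx[y [t [Xy Ayt _ lt]]]; exists y => //.
  by rewrite distrC; apply: Py0; split=> //; exists t.
apply: cA => e /approx[y [t [Xy Ayt lt Clt]]]; exists y, t; split=> //.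
by rewrite distrC; apply: Py0; split=> //; exists t.
Qed.

Section Fredholm.
Context (U V : hilbertType theta) (G : set (U * V)) (Z : set V).
Context (n : nat) (e : 'I_n -> V).
Hypotheses (lG : lsub G) (cG : rel_closed G) (lZ : lsub Z) (cZ : approx_closed Z).
Hypothesis GZ : (rimg G `<=` Z)%classic.
Hypothesis ZG : forall z, Z z ->
  exists w c, rimg G w /\ z = w + \sum_(i < n) c i *: e i.

Lemma adjr_proj y t : adjr G (y, t) -> exists2 y', Z y' & adjr G (y', t).
Proof.
move=> yt; have [y' Zy' oy'] := proj_closed RC lZ cZ y.
exists y' => // x w Gxw; rewrite /= -(yt _ _ Gxw) /=.
apply/eqP; rewrite eq_sym -subr_eq0 -linearBr /=; apply/eqP/inner_eq0C.
by apply: oy'; apply: GZ; exists x.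
Qed.

(* Closed range theorem for the adjoint, by the uniform bound on the vectors of
   [Z] orthogonal to the finitely many [e i]. *)
Lemma orth_rker_adjr u : orth (rker G) u -> exists2 w, Z w & adjr G (w, u).
Proof.
move=> ou.
pose X := [set y | Z y /\ forall i, inner y (e i) = 0]%classic.
have lX : lsub X.
  split=> [|a x y [Zx ox] [Zy oy]].
    by split=> [|i]; [exact: lZ.1|rewrite linear0l].
  split=> [|i]; first exact: lZ.2.
  by rewrite linearPl /= ox oy mulr0 addr0.
have cX : approx_closed X.
  move=> l lcl; split=> [|i].
    by apply: cZ => d /lcl[x [Zx _]]; exists x.
  have : orth [set e i]%classic l.
    by apply: (orth_closed RC) => d /lcl[x [_ ox] lx]; exists x => // _ ->.
  by move=> /(_ _ erefl).
have [|C C0 XC] := uniform_bound (adjr_lsub G) lX cX.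
  move=> z [/ZG[w [c [[x Gxw] ->]]] _]; exists `|x| => y t [_ oy] yt.
  rewrite linearDl /= (yt _ _ Gxw) linear_sumlz big1 ?addr0.
    exact: (cauchy_schwarz RC).
  by move=> i _; rewrite linearZl /= (inner_eq0C (oy i)) mulr0.
pose phi i : {scalar (V * U)%type} := applyr inner (e i) \o fst.
have lY : lsub [set q : V * U | Z q.1 /\ adjr G q]%classic.
  split=> [|a x y [Zx ax] [Zy ay]]; first by split; [exact: lZ.1|exact: (adjr_lsub G).1].
  by split; [exact: lZ.2|exact: (adjr_lsub G).2].
have [|s [[y t] [/= Zy yt] /= ts] os] := has_proj_fin_codim (g := snd) (phi := phi) lY _ u.
  have -> : (snd @` [set x : V * U | [set q : V * U | Z q.1 /\ adjr G q] x
              /\ forall i, phi i x = 0])%classic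
      = [set t | exists2 y, X y & adjr G (y, t)]%classic.
    apply/seteqP; split=> [_ [[y t] /= [[Zy yt] oy] <-]|t [y [Zy oy] yt]].
      by exists y.
    by exists (y, t).
  apply: (proj_closed RC) => //; last first.
    exact: (img_closed (adjr_lsub G) (adjr_closed RC (G := G)) lX cX C0 XC).
  split=> [|a s t [x Xx xs] [y Xy yt]].
    by exists 0; [exact: lX.1|exact: (adjr_lsub G).1].
  exists (a *: x + y); first exact: lX.2.
  exact: ((adjr_lsub G).2 a (x, s) (y, t)).
have kus : G (u - s, 0).
  apply: (adjr_bidual RC) => // y' z' /adjr_proj[y'' Zy'' yz].
  by rewrite linear0l os //; exists (y'', z').
have us : u = s.
  apply/eqP; rewrite -subr_eq0; apply/eqP/inner_self_eq0.
  have os' := os s (ex_intro2 _ _ (y, t) (conj Zy yt) ts).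
  rewrite linearBr /= os' subr0; apply: inner_eq0C; exact: ou.
by exists y => //; rewrite us -ts.
Qed.

Lemma rimg_has_proj : has_proj (rimg G).
Proof.
have lK := rker_lsub lG; have cK := rker_closed cG.
pose X := orth (rker G).
have [|C C0 XC] := uniform_bound lG (orth_lsub _ : lsub X) (orth_closed RC (S := _)).
  move=> z /orth_rker_adjr[w _ wz]; exists `|w| => x t _ Gxt.
  rewrite (norm_innerC RC) -(wz _ _ Gxt) /= mulrC; exact: (cauchy_schwarz RC).
have -> : rimg G = [set t | exists2 y, X y & G (y, t)]%classic.
  apply/seteqP; split=> w [x]; last by move=> _ Gxw; exists x.
  move=> Gxw; have [k Gk ok] := proj_closed RC lK cK x.
  exists (x - k); first exact: ok.
  by rewrite -[w]subr0; exact: (lsubB lG Gxw Gk).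
apply: (proj_closed RC) => //; last first.
  exact: (img_closed lG cG (orth_lsub _) (orth_closed RC (S := _)) C0 XC).
split=> [|a s t [x Xx xs] [y Xy yt]].
  by exists 0; [exact: (orth_lsub _).1|exact: lG.1].
exists (a *: x + y); first exact: (orth_lsub _).2.
exact: (lG.2 a (x, s) (y, t)).
Qed.

End Fredholm.
End ClosedRange.

(** * Linear isomorphisms and cohomology *)

Section LinearAlgebra.
Context (K : numFieldType).

Lemma lin_iso_rel (U V : lmodType K) (rho : U -> V -> Prop) :
  (forall a u v u' v', rho u v -> rho u' v' -> rho (a *: u + u') (a *: v + v')) ->
  (forall u, exists v, rho u v) -> (forall v, exists u, rho u v) ->
  (forall u v, rho u v -> u = 0 <-> v = 0) ->
  lin_iso U V.
Proof.
move=> rhoP tot surj rho0.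
have [f fP] := choice tot; have [g gP] := choice surj.
have rhoB u v u' v' : rho u v -> rho u' v' -> rho (u' - u) (v' - v).
  by move=> uv uv'; have := rhoP (-1) _ _ _ _ uv uv'; rewrite 2!scaleN1r addrC [- v + _]addrC.
have uniqr u v v' : rho u v -> rho u v' -> v = v'.
  move=> uv uv'; have [h _] := rho0 _ _ (rhoB _ _ _ _ uv' uv).
  by apply/eqP; rewrite -subr_eq0 h ?subrr.
have uniql u u' v : rho u v -> rho u' v -> u = u'.
  move=> uv uv'; have [_ h] := rho0 _ _ (rhoB _ _ _ _ uv' uv).
  by apply/eqP; rewrite -subr_eq0 h ?subrr.
have flin : linear f by move=> a u u'; apply: uniqr (fP _) _; apply: rhoP.
pose F : {linear U -> V} := HB.pack f (GRing.isLinear.Build K U V *:%R f flin).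
exists F; exists g => [u|v] /=.
- exact: uniql (gP _) (fP _).
- exact: uniqr (fP _) (gP _).
Qed.

Section Cohomology.
Context (U V W : lmodType K) (S : linop U V) (T : linop V W).

Definition is_class (x : V) (alpha : cohomology S T) : Prop :=
  exists hx : x \in lker T,
    alpha = lquot_pi (tracesp (lker T) (limg S)) (exist _ x hx : subsp (lker T)).

Lemma is_class_lker x alpha : is_class x alpha -> x \in lker T.
Proof. by case. Qed.

Lemma is_class_mk x : x \in lker T -> exists alpha, is_class x alpha.
Proof. by move=> hx; exists (lquot_pi _ (exist _ x hx : subsp (lker T))), hx. Qed.

Lemma is_class_repr alpha : exists x, is_class x alpha.
Proof.
rewrite -(lquot_repr alpha); move: (generic_quotient.repr _) => -[x hx].
by exists x, hx.
Qed.

Lemma is_classP a x y alpha beta : is_class x alpha -> is_class y beta ->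
  is_class (a *: x + y) (a *: alpha + beta).
Proof.
move=> [hx ->] [hy ->].
have hxy : a *: x + y \in lker T by rewrite rpredD ?rpredZ.
exists hxy; apply: esym.
pose x' : subsp (lker T) := exist _ x hx; pose y' : subsp (lker T) := exist _ y hy.
apply: etrans (_ : lquot_pi _ (a *: x' + y') = _).
  by congr lquot_pi; apply: val_inj.
by rewrite lquot_piD lquot_piZ.
Qed.

Lemma is_class_eq x y alpha beta : is_class x alpha -> is_class y beta ->
  alpha = beta <-> x - y \in limg S.
Proof. by move=> [hx ->] [hy ->]; apply: lquot_piP. Qed.

Lemma is_class0 x alpha : is_class x alpha -> alpha = 0 <-> x \in limg S.
Proof.
move=> hx; have h0 : is_class 0 (0 : cohomology S T).
  have := is_classP (-1) hx hx; rewrite !scaleN1r !addNr //.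
by have := is_class_eq hx h0; rewrite subr0.
Qed.

Lemma fin_dim_cohomology : fin_dim (cohomology S T) ->
  exists n (e : 'I_n -> V), forall z, z \in lker T ->
    exists w c, w \in limg S /\ z = w + \sum_(i < n) c i *: e i.
Proof.
move=> [n [eps epsP]].
have [e eP] := choice (fun i => is_class_repr (eps i)).
exists n, e => z hz; have [alpha za] := is_class_mk hz.
have [c ac] := epsP alpha.
have sumP : is_class (\sum_(i < n) c i *: e i) (\sum_(i < n) c i *: eps i).
  elim/big_ind2: _ => [|x a y b xa yb|i _].
  - by have := is_classP (-1) za za; rewrite !scaleN1r !addNr.
  - by have := is_classP 1 xa yb; rewrite !scale1r.
  - by have := is_classP (c i - 1) (eP i) (eP i); rewrite !scalerBl !scale1r !subrK.
exists (z - \sum_(i < n) c i *: e i), c; split; last by rewrite subrK.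
by apply/(is_class_eq za sumP).
Qed.

End Cohomology.

End LinearAlgebra.

Section Graph.
Context (R : realType) (K : numFieldType) (theta : {rmorphism K -> K}).
Context (U V : hilbertType theta).
Implicit Type T : linop U V.

Definition graph T : set (U * V) := [set p | p.1 \in dom T /\ T p.1 = p.2]%classic.

Lemma graph_lsub T : lsub (graph T).
Proof.
split=> [|a [x w] [y s] [/= Dx <-] [/= Dy <-]]; first by split; rewrite /= ?rpred0 ?linop0.
by split; rewrite /= ?opfun_linear // rpredD ?rpredZ.
Qed.

Lemma graph_closed T : closed_op T -> rel_closed (graph T).
Proof.
move=> cT l m lm; apply: cT => B /nbhs_ballP[e /= e0 eB].
have [x [w [Gxw lx mw]]] := lm (e / 2) (divr_gt0 e0 (ltr0n _ 2)).
have e2 : e / 2 < e by rewrite ltr_pdivrMr ?ltr0n // ltr_pMr // ltr1n.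
exists (x, w); split=> //; apply: eB.
by split; rewrite -ball_normE /=; apply: le_lt_trans e2.
Qed.

Lemma rker_graph T x : rker (graph T) x <-> x \in lker T.
Proof.
by split=> [[/= Dx /eqP Tx]|/andP[Dx /eqP Tx]]; [apply/andP|split].
Qed.

Lemma rimg_graph T w : rimg (graph T) w <-> w \in limg T.
Proof. by rewrite inE; split=> -[x]; exists x. Qed.

Lemma adjr_graph T (dT : dense_op T) y z :
  adjr (graph T) (y, z) <-> y \in dom (adj dT) /\ adj dT y = z.
Proof.
have E : adjr (graph T) (y, z) <-> adj_rel T y z.
  by split=> [h x Dx|h x _ [/= Dx <-]]; [apply: h|apply: h].
split=> [/E yz|[Dy yz]]; last by apply/E; rewrite -yz; apply: adj_funP.
have Dy : y \in dom (adj dT) by rewrite inE; exists z.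
by split=> //; apply: (adj_rel_uniq dT (adj_funP Dy)).
Qed.

End Graph.

(** * Pairs of Hilbert complexes *)

Section Intermediate.
Context (K : numFieldType) (theta : {rmorphism K -> K}).
Context (V : hilbertType theta).

Lemma has_proj_intermediate (S B : set V) n (e : 'I_n -> V) :
  lsub S -> has_proj S -> lsub B -> (S `<=` B)%classic ->
  (forall b, B b -> exists c : 'I_n -> K, S (b - \sum_(i < n) c i *: e i)) ->
  has_proj B.
Proof.
move=> lS pS lB SB Be.
pose X := [set p : V * 'rV[K]_n | B p.1 /\ S (p.1 - \sum_(i < n) p.2 0 i *: e i)]%classic.
have lin i : scalar (fun p : V * 'rV[K]_n => p.2 0 i).
  by move=> a p q; rewrite /= !mxE.
pose phi i : {scalar (V * 'rV[K]_n)%type} :=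
  HB.pack (fun p : V * 'rV[K]_n => p.2 0 i) (GRing.isLinear.Build K _ K *%R _ (lin i)).
have lX : lsub X.
  split=> [|a [x c] [y d] [/= Bx Sx] [/= By Sy]].
    split; first exact: lB.1.
    by rewrite /= big1 ?subr0; [exact: lS.1|move=> i _; rewrite mxE scale0r].
  split; first exact: lB.2.
  rewrite /= (_ : _ - _ = a *: (x - \sum_(i < n) c 0 i *: e i)
      + (y - \sum_(i < n) d 0 i *: e i)); first exact: lS.2.
  rewrite scalerBr scaler_sumr addrACA -opprD -big_split /=; congr (_ - _).
  by apply: eq_bigr => i _; rewrite !mxE scalerDl scalerA.
have -> : B = (fst @` X)%classic.
  apply/seteqP; split=> [b Bb|_ [p [Bp _] <-] //].
  have [c Sc] := Be b Bb; exists (b, \row_i c i) => //; split=> //=.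
  by under eq_bigr do rewrite mxE.
apply: (has_proj_fin_codim (g := fst) (phi := phi) lX).
suff -> : (fst @` [set p | X p /\ forall i, phi i p = 0])%classic = S by [].
apply/seteqP; split=> [_ [[b c] [[/= _ Sbc] c0] <-]|s Ss] /=.
  by move: Sbc; rewrite big1 ?subr0 // => i _; have /= -> := c0 i; rewrite scale0r.
exists (s, 0) => //; split=> [|i /=]; last by rewrite mxE.
split; first exact: SB.
by rewrite /= big1 ?subr0 // => i _; rewrite mxE scale0r.
Qed.

End Intermediate.

Lemma rel_subB (K : numFieldType) (U V : lmodType K) (G : set (U * V)) x w x' w' :
  lsub G -> G (x, w) -> G (x', w') -> G (x - x', w - w').
Proof. by move=> lG Gx Gx'; exact: (lsubB lG Gx Gx'). Qed.

Section Complex.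
Context (R : realType) (K : numFieldType) (theta : {rmorphism K -> K}).
Hypothesis RC : real_or_complex R theta.
Context (n : nat) (H : int -> hilbertType theta) (CM Cm : hilbert_complex n H).
Hypotheses (pair : extension_pair CM Cm) (fredholm_CM : fredholm CM).

Local Notation dM pq := (graph (cdiff CM pq)).
Local Notation dm pq := (graph (cdiff Cm pq)).

Lemma dM_lsub p q (pq : q = p + 1) : lsub (dM pq).
Proof. exact: graph_lsub. Qed.

Lemma dM_closed p q (pq : q = p + 1) : rel_closed (dM pq).
Proof. exact/graph_closed/cdiff_closed. Qed.

Lemma rker_dM_lsub p q (pq : q = p + 1) : lsub (rker (dM pq)).
Proof. exact/rker_lsub/dM_lsub. Qed.

Lemma rker_dM_closed p q (pq : q = p + 1) : approx_closed (rker (dM pq)).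
Proof. by apply: rker_closed; exact: dM_closed. Qed.

Lemma dm_dM p q (pq : q = p + 1) x w : dm pq (x, w) -> dM pq (x, w).
Proof. by move=> [/= Dx <-]; split=> /=; have [] := pair Dx. Qed.

Lemma rimg_rker p q r (pq : q = p + 1) (qr : r = q + 1) :
  (rimg (dM pq) `<=` rker (dM qr))%classic.
Proof. by move=> w [x [/= Dx <-]]; split=> /=; [exact: cdiff_dom|exact: cdiff_diff]. Qed.

Lemma adjr_dM p q (pq : q = p + 1) y z : adjr (dM pq) (y, z) -> adjr (dm pq) (y, z).
Proof. by move=> yz x w /dm_dM; apply: yz. Qed.

Lemma fredholm_span p q r (pq : q = p + 1) (qr : r = q + 1) :
  exists m (e : 'I_m -> H q), forall z, rker (dM qr) z ->
    exists w c, rimg (dM pq) w /\ z = w + \sum_(i < m) c i *: e i.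
Proof.
have Ep : p = q - 1 by rewrite pq addrK.
subst r p; rewrite (eq_irrelevance pq (prevE q)).
have [m [e eP]] := fin_dim_cohomology (fredholm_CM q).
exists m, e => z /rker_graph/eP[w [c [wS zE]]]; exists w, c; split=> //.
exact/rimg_graph.
Qed.

Lemma orth_rker_adjr_dM p q (pq : q = p + 1) u : orth (rker (dM pq)) u ->
  exists2 w, rker (dM (erefl (q + 1))) w & adjr (dM pq) (w, u).
Proof.
have [m [e eP]] := fredholm_span pq (erefl (q + 1)).
apply: (orth_rker_adjr RC (dM_lsub pq) (dM_closed (pq := pq)) _ _ (@rimg_rker _ _ _ _ _) eP).
  exact: rker_dM_lsub.
exact: rker_dM_closed.
Qed.

Lemma rimg_dM_has_proj p q (pq : q = p + 1) : has_proj (rimg (dM pq)).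
Proof.
have [m [e eP]] := fredholm_span pq (erefl (q + 1)).
apply: (rimg_has_proj RC (dM_lsub pq) (dM_closed (pq := pq)) _ _ (@rimg_rker _ _ _ _ _) eP).
  exact: rker_dM_lsub.
exact: rker_dM_closed.
Qed.

Lemma rker_dM_has_proj p q (pq : q = p + 1) : has_proj (rker (dM pq)).
Proof.
apply: (proj_closed RC); first exact: rker_dM_lsub.
exact: rker_dM_closed.
Qed.

Lemma harmonic_repr p q r (pq : q = p + 1) (qr : r = q + 1) a :
  rker (dM qr) a -> exists h, [/\ rker (dM qr) h, rker (adjr (dM pq)) h
    & rimg (dM pq) (a - h)].
Proof.
move=> ka; have [w Rw ow] := rimg_dM_has_proj pq a.
exists (a - w); split.
- by apply: lsubB => //; [exact: rker_dM_lsub|exact: rimg_rker Rw].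
- by rewrite rker_adjr.
- by rewrite subKr.
Qed.

Section Degrees.
Variables (o p q : int) (op : p = o + 1) (pq : q = p + 1).

(* The sum of [rimg (dM op)] and of the [delta_M]-exact vectors of [ker d_M] is
   a closed subspace of [ker d_M], having finite codimension. A vector [k] of
   [ker d_M] orthogonal to it is orthogonal to the range of [delta_M]: the
   component of [delta_M y] orthogonal to [ker d_M] is in the range of
   [delta_m], hence of [delta_M], and is orthogonal to [k]. *)
Lemma decomposition b : rker (dM pq) b -> exists k s c,
  [/\ rker (dm pq) k, rker (adjr (dM op)) k, rimg (dM pq) s,
      adjr (dm pq) (s, c) /\ rker (dM pq) c & rimg (dM op) (b - (c + k))].
Proof.
move=> kb; have lk : lsub (rker (dM pq)) by exact: rker_dM_lsub.
have lr : lsub (rimg (dM op)) by exact/rimg_lsub/dM_lsub.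
pose E := [set x | rker (dM pq) x /\ exists c, [/\ rker (dM pq) c,
   rimg (adjr (dm pq)) c & rimg (dM op) (x - c)]]%classic.
have lE : lsub E.
  split=> [|a x y [kx [c [kc dc xc]]] [ky [d [kd dd yd]]]].
    split; first exact: lk.1; exists 0; rewrite subr0; split; first exact: lk.1.
      by exists 0; exact: (adjr_lsub _).1.
    exact: lr.1.
  split; first exact: lk.2.
  exists (a *: c + d); split; first exact: lk.2.
    exact: (rimg_lsub (adjr_lsub _)).2.
  by rewrite opprD addrACA -scalerBr; apply: lr.2.
have pE : has_proj E.
  have [m [e eP]] := fredholm_span op pq.
  apply: (has_proj_intermediate (S := rimg (dM op)) (e := e)) => //.
  - exact: rimg_dM_has_proj.
  - move=> w Rw; split; first exact: rimg_rker Rw.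
    exists 0; rewrite subr0; split=> //; first exact: lk.1.
    by exists 0; exact: (adjr_lsub _).1.
  - by move=> x [/eP[w [c [Rw ->]]] _]; exists c; rewrite addrK.
have [w [kw [c [kc [y yc] wc]]] ow] := pE b.
pose k := b - w.
have kk : rker (dM pq) k by exact: lsubB.
have k_op : rker (adjr (dM op)) k.
  rewrite rker_adjr => x Rx; apply: ow; split; first exact: rimg_rker Rx.
  exists 0; rewrite subr0; split=> //; first exact: lk.1.
  by exists 0; exact: (adjr_lsub _).1.
have k_pq : rker (dm pq) k.
  apply: (adjr_bidual RC); [exact: graph_lsub|exact/graph_closed/cdiff_closed|].
  move=> y' z' yz'; rewrite linear0l.
  have [c' kc' oc'] := rker_dM_has_proj pq z'.
  have [v _ vz] := orth_rker_adjr_dM oc'.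
  rewrite -[z'](subrK c') linearDr /= (inner_eq0C (oc' _ kk)) add0r; apply: ow.
  split=> //; exists c'; split=> //; last by rewrite subrr; exact: lr.1.
  exists (y' - v); have := rel_subB (adjr_lsub _) yz' (adjr_dM vz).
  by rewrite subKr.
have [s Rs os] := rimg_dM_has_proj pq y.
exists k, s, c; split=> //; last by rewrite /k opprD addrCA subKr [- c + _]addrC.
split=> //.
have sy : adjr (dM pq) (y - s, 0) by have : rker (adjr (dM pq)) (y - s) by rewrite rker_adjr.
by have := rel_subB (adjr_lsub _) yc (adjr_dM sy); rewrite subKr subr0.
Qed.

(* [s] is [d_M t] with [t] orthogonal to [ker d_M], so that [delta_M t = 0],
   and [d_M u = d_M (delta_m w)] with [w] in [ker d_M]; then [t - w] is as
   required. *)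
Lemma exact_primitive s c k : rimg (dM pq) s -> adjr (dm pq) (s, c) ->
  rker (dm pq) k -> rker (adjr (dM op)) k -> rimg (dM op) (c + k) ->
  k = 0 /\ exists t e, [/\ dM pq (t, s), adjr (dm op) (t, e) & dM op (e, - c)].
Proof.
move=> [t ts] sc k_pq k_op [u uck].
have k0 : k = 0.
  apply: inner_self_eq0; rewrite -{1}[k](addKr c) linearDl /= linearNl /=.
  have -> : inner c k = 0.
    by apply: inner_eq0C; rewrite -(sc _ _ k_pq) linear0l.
  by rewrite (k_op _ _ uck) linear0r oppr0 addr0.
split=> //; move: uck; rewrite k0 addr0 => uc.
have [t1 kt1 ot1] := rker_dM_has_proj pq t.
have [u1 ku1 ou1] := rker_dM_has_proj op u.
have [w _ wu] := orth_rker_adjr_dM ou1.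
have [w2 kw2 ow2] := rker_dM_has_proj pq w.
have w2u : adjr (dM op) (w2, u - u1).
  have ww : adjr (dM op) (w - w2, 0).
    have : rker (adjr (dM op)) (w - w2); last by [].
    by rewrite rker_adjr => x Rx; apply: ow2; exact: rimg_rker Rx.
  by have := rel_subB (adjr_lsub _) wu ww; rewrite subKr subr0.
have tt : adjr (dM op) (t - t1, 0).
  have : rker (adjr (dM op)) (t - t1); last by [].
  by rewrite rker_adjr => x Rx; apply: ot1; exact: rimg_rker Rx.
exists (t - t1 - w2), (- (u - u1)); split.
- have := rel_subB (dM_lsub pq) (rel_subB (dM_lsub pq) ts kt1) kw2.
  by rewrite !subr0.
- apply: adjr_dM; have := rel_subB (adjr_lsub _) tt w2u.
  by rewrite sub0r.
- have := rel_subB (dM_lsub op) (dM_lsub op).1 (rel_subB (dM_lsub op) uc ku1).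
  by rewrite subr0 !sub0r.
Qed.

End Degrees.
End Complex.

Section Harmonic.
Context (R : realType) (K : numFieldType) (theta : {rmorphism K -> K}).
Hypothesis RC : real_or_complex R theta.
Context (n : nat) (H : int -> hilbertType theta) (CM Cm : hilbert_complex n H).
Hypotheses (pair : extension_pair CM Cm) (fredholm_CM : fredholm CM).

Local Notation dM pq := (graph (cdiff CM pq)).
Local Notation dm pq := (graph (cdiff Cm pq)).

Lemma lker_cdiff (C : hilbert_complex n H) p q r (pq : q = p + 1) (pr : r = p + 1)
  (x : H p) : (x \in lker (cdiff C pq)) = (x \in lker (cdiff C pr)).
Proof. by subst q; subst r. Qed.

Lemma adjr_codiff (C : hilbert_complex n H) p q (pq : q = p + 1) x :
  x \in dom (codiff C pq) -> adjr (graph (cdiff C pq)) (x, codiff C pq x).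
Proof. by move=> Dx; apply/(adjr_graph (cdiff_dense C pq)). Qed.

Lemma lker_codiff (C : hilbert_complex n H) p q (pq : q = p + 1) x :
  x \in lker (codiff C pq) <-> rker (adjr (graph (cdiff C pq))) x.
Proof.
split=> [/andP[Dx /eqP E]|/(adjr_graph (cdiff_dense C pq))[Dx E]].
  by have := adjr_codiff Dx; rewrite E.
by apply/andP; split=> //; apply/eqP.
Qed.

Variable q : int.
Local Notation lap q := (laplacian CM Cm q).
Local Notation hout := (totalop (harmonic_diff CM Cm (erefl (q + 1)))).
Local Notation hin := (totalop (harmonic_diff CM Cm (prevE q))).

Lemma mem_lker_harmonic (x : subsp (lker (lap q))) :
  x \in lker hout <-> cdiff CM (erefl (q + 1)) (val x) = 0.
Proof.
split=> [/andP[_ /eqP/(congr1 val)] //|E].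
by apply/andP; split=> //; apply/eqP/val_inj.
Qed.

Lemma mem_limg_harmonic (x : subsp (lker (lap q))) : x \in limg hin <->
  exists2 t, t \in lker (lap (q - 1)) & cdiff CM (prevE q) t = val x.
Proof.
rewrite inE; split=> [[t [_ <-]]|[t ht E]].
  by exists (val t); first exact: valP.
by exists (exist _ t ht); split=> //; apply: val_inj.
Qed.

Lemma harmonic_cocycle (x : subsp (lker (lap q))) : x \in lker hout ->
  [/\ val x \in dom (codiff Cm (prevE q)), rker (dM (erefl (q + 1))) (val x)
    & rker (dM (prevE q)) (codiff Cm (prevE q) (val x))].
Proof.
move=> /mem_lker_harmonic dx0.
have [Dd Ddd Dx _ P0] := (laplacian_kerP CM Cm (prevE q) (erefl (q + 1)) (val x)).1 (valP x).
split=> //; split=> //; move: P0.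
by rewrite dx0 linop0 addr0.
Qed.

Lemma harmonic_cocycle_mk s c : rker (dM (erefl (q + 1))) s ->
  adjr (dm (prevE q)) (s, c) -> rker (dM (prevE q)) c ->
  exists2 x : subsp (lker (lap q)), x \in lker hout & val x = s.
Proof.
move=> [/= Ds ds0] /(adjr_graph (cdiff_dense Cm (prevE q)))[Dc sc] [/= Ddc dc0].
have hs : s \in lker (lap q).
  apply/(laplacian_kerP CM Cm (prevE q) (erefl (q + 1))).
  rewrite /codiff sc ds0 linop0 dc0 addr0; split=> //; exact: rpred0.
by exists (exist _ s hs) => //; apply/mem_lker_harmonic.
Qed.

Lemma harmonic_mP (k : harmonic_m CM Cm (q - 1)) :
  rker (dm (prevE q)) (val k) /\ rker (adjr (dM (prevE (q - 1)))) (val k).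
Proof.
case/andP: (valP k) => k1 k2; split; last exact/lker_codiff.
by apply/rker_graph; rewrite (lker_cdiff Cm _ (erefl (q - 1 + 1))).
Qed.

Lemma harmonic_m_mk k : rker (dm (prevE q)) k ->
  rker (adjr (dM (prevE (q - 1)))) k ->
  exists x : harmonic_m CM Cm (q - 1), val x = k.
Proof.
move=> k1 k2; suff hk : k \in capsp (lker (diff_out Cm (q - 1))) (lker (codiff CM (prevE (q - 1)))).
  by exists (exist _ k hk).
apply/andP; split; last exact/lker_codiff.
by rewrite /diff_out (lker_cdiff Cm _ (prevE q)); apply/rker_graph.
Qed.

Definition harmonic_class_rel
    (u : harmonic_Hcoh CM Cm q * harmonic_m CM Cm (q - 1))
    (v : Hcoh CM q * Hcoh CM (q - 1)) : Prop :=
  exists x : subsp (lker (lap q)), [/\ is_class x u.1, is_class (val x) v.1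
    & is_class (codiff Cm (prevE q) (val x) + val u.2) v.2].

Lemma harmonic_class_rel_linear a u v u' v' :
  harmonic_class_rel u v -> harmonic_class_rel u' v' ->
  harmonic_class_rel (a *: u + u') (a *: v + v').
Proof.
move=> [x [ux xv xkv]] [y [uy yv ykv]]; exists (a *: x + y).
have [Dx _ _] := harmonic_cocycle (is_class_lker ux).
have [Dy _ _] := harmonic_cocycle (is_class_lker uy).
split; first exact: is_classP.
  by rewrite linearP; exact: is_classP.
have -> : codiff Cm (prevE q) (val (a *: x + y)) + val (a *: u + u').2
    = a *: (codiff Cm (prevE q) (val x) + val u.2)
      + (codiff Cm (prevE q) (val y) + val u'.2).
  by rewrite !linearP (opfun_linear (l := codiff Cm (prevE q)) a Dx Dy) addrACA scalerDr.
exact: is_classP.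
Qed.

Lemma harmonic_class_rel_total u : exists v, harmonic_class_rel u v.
Proof.
case: u => alpha k; have [x ax] := is_class_repr alpha.
have [Dx kx kdx] := harmonic_cocycle (is_class_lker ax).
have [k1 k2] := harmonic_mP k.
have [beta xb] : exists beta : Hcoh CM q, is_class (val x) beta.
  by apply: is_class_mk; apply/rker_graph.
have [gamma xg] : exists gamma : Hcoh CM (q - 1),
    is_class (codiff Cm (prevE q) (val x) + val k) gamma.
  apply: is_class_mk; rewrite /diff_out (lker_cdiff CM _ (prevE q)).
  apply: rpredD; apply/rker_graph => //; exact: dm_dM.
by exists (beta, gamma), x.
Qed.

Lemma harmonic_class_rel_surj v : exists u, harmonic_class_rel u v.
Proof.
case: v => beta gamma.
have [a ab] := is_class_repr beta; have [b bg] := is_class_repr gamma.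
have ka : rker (dM (erefl (q + 1))) a by apply/rker_graph/(is_class_lker ab).
have kb : rker (dM (prevE q)) b.
  by apply/rker_graph; rewrite (lker_cdiff CM _ (erefl (q - 1 + 1))); exact: is_class_lker bg.
have [h [kh h_pq ah]] := harmonic_repr RC fredholm_CM (prevE q) ka.
have [k [s [c [k1 k2 Rs [sc kc] bck]]]] :=
  decomposition RC pair fredholm_CM (prevE (q - 1)) kb.
have hsc : adjr (dm (prevE q)) (h + s, c).
  rewrite -[c]add0r; exact: (lsubD (adjr_lsub _) (adjr_dM pair h_pq) sc).
have khs : rker (dM (erefl (q + 1))) (h + s).
  by apply: lsubD => //; [exact: rker_dM_lsub|exact: rimg_rker Rs].
have [x hx xE] := harmonic_cocycle_mk khs hsc kc.
have [k' k'E] := harmonic_m_mk k1 k2.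
have [alpha xa] := is_class_mk hin hx.
exists (alpha, k'), x; split=> //.
  have [beta' xb'] : exists beta' : Hcoh CM q, is_class (val x) beta'.
    by apply: is_class_mk; apply/rker_graph; rewrite xE.
  suff -> : beta = beta' by [].
  apply/(is_class_eq ab xb'); rewrite xE opprD addrA; apply: rpredB.
    exact/rimg_graph.
  exact/rimg_graph.
have -> : codiff Cm (prevE q) (val x) = c.
  by rewrite xE; have [] := (adjr_graph (cdiff_dense Cm (prevE q)) _ _).1 hsc.
rewrite /= k'E.
have [gamma' xg'] : exists gamma' : Hcoh CM (q - 1), is_class (c + k) gamma'.
  apply: is_class_mk; rewrite /diff_out (lker_cdiff CM _ (prevE q)).
  apply: rpredD; apply/rker_graph => //; exact: dm_dM.
suff -> : gamma = gamma' by [].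
by apply/(is_class_eq bg xg'); apply/rimg_graph.
Qed.

Lemma harmonic_class_rel0 u v : harmonic_class_rel u v -> u = 0 <-> v = 0.
Proof.
case: u v => alpha k [beta gamma] [x [/= xa xb xg0]].
have xg : is_class (codiff Cm (prevE q) (val x) + val k) gamma := xg0.
have [Dx kx kdx] := harmonic_cocycle (is_class_lker xa).
have [k1 k2] := harmonic_mP k.
have sc := adjr_codiff Dx.
split=> [[a0 k0]|[b0 g0]].
  have /mem_limg_harmonic[t ht tx] := (is_class0 xa).1 a0.
  have [Dt Ddt Dxt Ddxt P0] :=
    (laplacian_kerP CM Cm (prevE (q - 1)) (prevE q) t).1 ht.
  have b0 : beta = 0 by apply/(is_class0 xb); rewrite -tx; apply/rimg_graph; exists t.
  suff g0 : gamma = 0 by rewrite b0 g0.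
  apply/(is_class0 xg); rewrite k0 addr0 -tx.
  have -> : codiff Cm (prevE q) (cdiff CM (prevE q) t)
      = - cdiff CM (prevE (q - 1)) (codiff Cm (prevE (q - 1)) t).
    by move/eqP: P0; rewrite addr_eq0 => /eqP->; rewrite opprK.
  by rewrite rpredN; apply/rimg_graph; exists (codiff Cm (prevE (q - 1)) t).
have Rx : rimg (dM (prevE q)) (val x) by apply/rimg_graph/(is_class0 xb).
have Rck : rimg (dM (prevE (q - 1))) (codiff Cm (prevE q) (val x) + val k).
  by apply/rimg_graph/(is_class0 xg).
have [k0 [t [e [tx te ec]]]] := exact_primitive RC pair fredholm_CM Rx sc k1 k2 Rck.
have {}k0 : k = 0 by apply: val_inj.
suff a0 : alpha = 0 by rewrite a0 k0.
apply/(is_class0 xa)/mem_limg_harmonic.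
have [/= Dt tE] := tx; have [/= De eE] := ec.
have [Dte teE] := (adjr_graph (cdiff_dense Cm (prevE (q - 1))) _ _).1 te.
exists t => //; apply/(laplacian_kerP CM Cm (prevE (q - 1)) (prevE q)).
by rewrite /codiff teE tE eE; split=> //; rewrite addNr.
Qed.

End Harmonic.

Theorem theorem1p0p1 (R : realType) (K : numFieldType)
    (theta : {rmorphism K -> K}) (RC : real_or_complex R theta)
    (n : nat) (H : int -> hilbertType theta) (CM Cm : hilbert_complex n H)
    (pair : extension_pair CM Cm) (fredholm_CM : fredholm CM) (q : int) :
  lin_iso (harmonic_Hcoh CM Cm q * harmonic_m CM Cm (q - 1))%type
          (Hcoh CM q * Hcoh CM (q - 1))%type.
Proof.
apply: (lin_iso_rel (rho := @harmonic_class_rel _ _ _ _ CM Cm q)).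
- exact: harmonic_class_rel_linear.
- exact: (harmonic_class_rel_total pair).
- exact: (harmonic_class_rel_surj RC pair fredholm_CM).
- exact: (harmonic_class_rel0 RC pair fredholm_CM).
Qed.
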